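(* Let $N\ge2$, let $\alpha>0$ be a constant and $T>0$. Let $f$ be a non-negative, bounded and measurable function on $\mathbb{R}^N\times(0,T)$. For a unit vector $m\in\mathbb{R}^N$ let $P_m$ be the orthogonal projection $P_mx=x-(x\cdot m)m$, $x\in\mathbb{R}^N$; identify $P_m\mathbb{R}^N$ with $\mathbb{R}^{N-1}$ and write $x'=P_mx$. Let $s_{0+},s_{0-}:\mathbb{R}^{N-1}\to\mathbb{R}$ be $C^2$ functions with bounded derivatives up to second order and with $s_{0-}<s_{0+}$ on $\mathbb{R}^{N-1}$. Let $$D_0=\{x\in\mathbb{R}^N \mid s_{0-}(x')<x\cdot m<s_{0+}(x')\},\qquad u_0\equiv0.$$ Then there exists no solution $(u,S(t))$ on $(0,T)$ (in the sense defined in the context) to the free boundary problem $$\partial_t u-\Delta u=f \ \text{ in } Q_T,\qquad u=0 \ \text{ on } S_T,\qquad \partial u/\partial\nu=-\alpha \ \text{ on } S_T,$$ with initial data $u|_{t=0}=u_0$, $S(t)|_{t=0}=S_0=\partial D_0$.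
   Context: Notation. $D(t)\subset\mathbb{R}^N$ $(0<t<T)$ are domains with boundary $S(t)=\partial D(t)$; $Q_T=\bigcup_{0<t<T}D(t)\times\{t\}$, $S_T=\bigcup_{0<t<T}S(t)\times\{t\}$; $\partial/\partial\nu$ is the exterior normal derivative of $D(t)$ on $S(t)$. Both $u$ and the free boundary $S(t)$ are unknown. Solution of the equations. A solution is a classical non-negative solution: $u=u(x,t)\ge0$ is $C^2$ in $x$ and $C^1$ in $t$ in $Q_T$, with $\nabla^2u,\partial_tu\in C(Q_T)$ and $u,\nabla u\in C(Q_T\cup S_T)$, satisfying the equation in $Q_T$ and the boundary conditions on $S_T$; moreover $S_T$ is uniformly $C^{2,1}$ ($C^2$ in space, $C^1$ in time) in $\mathbb{R}^N\times(\varepsilon,T)$ for every $\varepsilon>0$. Solution of the initial value problem. In addition, $u$ is bounded and is continuous up to $t=0$ on $\overline{D_0}$ with value $u_0$ there (i.e. $u$ extended by $u_0$ on $\overline{D_0}\times\{0\}$ is continuous), and $S(t)\to S_0$ as $t\downarrow0$ in the uniform $C^2$ topology. No control of the time derivative of $S(t)$ up to $t=0$ is assumed. In the present situation this means $D(t)=\{x\in\mathbb{R}^N\mid s_-(t,x')<x\cdot m<s_+(t,x')\}$ with $s_-<s_+$, where $s_\pm$ are $C^1$ in $t$ and $C^2$ in $x'$ on $(0,T)\times\mathbb{R}^{N-1}$, $\partial_ts_\pm$ and the first and second order $x'$-derivatives of $s_\pm$ are bounded on $(\varepsilon,T)\times\mathbb{R}^{N-1}$ for every $\varepsilon>0$,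 and $s_\pm(t,\cdot)-s_{0\pm}$ together with its $x'$-derivatives up to second order tends to $0$ uniformly on $\mathbb{R}^{N-1}$ as $t\downarrow0$. *)

(* Defs.v *)
(* R^N is 'rV[R]_N, space-time points are pairs
   (x, t) : 'rV[R]_N * R.  The topology of 'rV[R]_N is the usual one; Euclidean
   lengths are expressed through [dot], as the library norm is the sup norm. *)
From mathcomp Require Export all_boot all_order all_algebra.
From mathcomp Require Export all_classical all_reals all_analysis.

Set Implicit Arguments.
Unset Strict Implicit.
Unset Printing Implicit Defensive.

Import Order.TTheory GRing.Theory Num.Theory.
Import numFieldNormedType.Exports.

Local Open Scope classical_set_scope.
Local Open Scope ring_scope.

Section EuclideanGeometry.
Context {R : realType} {N : nat}.
Implicit Types (x y m : 'rV[R]_N) (A : set 'rV[R]_N).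

Definition dot x y : R := \sum_(i < N) x 0 i * y 0 i.

Definition frontier A : set 'rV[R]_N := closure A `\` A°.

Definition orthoproj m x : 'rV[R]_N := x - dot x m *: m.

(* An identification of the hyperplane orthogonal to the unit vector m with
   R^(N-1): the rows of E form an orthonormal basis of that hyperplane. *)
Definition hyperplane_frame m (E : 'M[R]_(N.-1, N)) :=
  E *m E^T = 1%:M /\ E *m m^T = 0.

(* x' : the coordinates of P_m x in the basis E *)
Definition tcoord m (E : 'M[R]_(N.-1, N)) x : 'rV[R]_(N.-1) :=
  orthoproj m x *m E^T.

Definition graph_domain m E (sm sp : 'rV[R]_(N.-1) -> R) : set 'rV[R]_N :=
  [set x | sm (tcoord m E x) < dot x m < sp (tcoord m E x)].

End EuclideanGeometry.

Section Regularity.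
Context {R : realType} {n : nat}.
Implicit Types (g : 'rV[R]_n -> R) (h : 'rV[R]_n * R -> R).

Definition evec (i : 'I_n) : 'rV[R]_n := delta_mx 0 i.

Definition pd i g : 'rV[R]_n -> R := fun x => 'D_(evec i) g x.

Definition C2 g := [/\
  forall x i, derivable g x (evec i),
  forall x i j, derivable (pd i g) x (evec j),
  continuous g,
  forall i, continuous (pd i g) &
  forall i j, continuous (pd j (pd i g))].

Definition bounded_derivatives2 g := exists M : R,
  (forall i x, `|pd i g x| <= M) /\ (forall i j x, `|pd j (pd i g) x| <= M).

Definition at_time h (t : R) : 'rV[R]_n -> R := fun x => h (x, t).

Definition pdx i h : 'rV[R]_n * R -> R := fun p => pd i (at_time h p.2) p.1.

Definition pdt h : 'rV[R]_n * R -> R := fun p => derive1 (fun t => h (p.1, t)) p.2.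

Definition grad h (p : 'rV[R]_n * R) : 'rV[R]_n := \row_i pdx i h p.

Definition laplacian h (p : 'rV[R]_n * R) : R := \sum_(i < n) pdx i (pdx i h) p.

(* C^2 in x and C^1 in t on the (open) set A, the derivatives being jointly
   continuous in (x, t). *)
Definition C21_on (A : set ('rV[R]_n * R)) h := [/\
  forall p, A p -> [/\ derivable (fun t => h (p.1, t)) p.2 1,
      forall i, derivable (at_time h p.2) p.1 (evec i) &
      forall i j, derivable (at_time (pdx i h) p.2) p.1 (evec j)],
  {within A, continuous h},
  {within A, continuous (pdt h)},
  forall i, {within A, continuous (pdx i h)} &
  forall i j, {within A, continuous (pdx j (pdx i h))}].

Definition spacetime (a b : R) : set ('rV[R]_n * R) := [set p | a < p.2 < b].

(* h(., t) -> g as t decreases to 0, uniformly with all x-derivatives up to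
   order two *)
Definition C2_uniform_limit0 h g := [/\
  {uniform, at_time h t @[t --> 0^'+] --> g},
  forall i, {uniform, at_time (pdx i h) t @[t --> 0^'+] --> pd i g} &
  forall i j, {uniform, at_time (pdx j (pdx i h)) t @[t --> 0^'+]
                        --> pd j (pd i g)}].

End Regularity.

Section Lebesgue.
Context {R : realType} {N : nat}.
Implicit Types (p q z : 'rV[R]_N * R) (A X : set ('rV[R]_N * R)).

Definition box p q : set ('rV[R]_N * R) :=
  [set z : 'rV[R]_N * R | (forall i, p.1 0 i < z.1 0 i < q.1 0 i) /\ p.2 < z.2 < q.2].

Definition box_volume p q : R :=
  (\prod_(i < N) Num.max 0 (q.1 0 i - p.1 0 i)) * Num.max 0 (q.2 - p.2).

Definition lebesgue_outer X : \bar R :=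
  ereal_inf [set v | exists a b : nat -> 'rV[R]_N * R,
    X `<=` \bigcup_k box (a k) (b k) /\
    v = (\sum_(0 <= k <oo) (box_volume (a k) (b k))%:E)%E].

Definition lebesgue_measurable_on A (f : 'rV[R]_N * R -> R) :=
  forall B : set R, measurable B ->
    lebesgue_outer.-caratheodory (A `&` f @^-1` B).

End Lebesgue.

Section FreeBoundaryProblem.
Context {R : realType} {N : nat}.
Variables (m : 'rV[R]_N) (E : 'M[R]_(N.-1, N)) (T : R).

Section MovingDomain.
Variables (sm sp : 'rV[R]_(N.-1) * R -> R).

Definition Dt (t : R) : set 'rV[R]_N :=
  graph_domain m E (at_time sm t) (at_time sp t).

Definition QT : set ('rV[R]_N * R) := [set p | 0 < p.2 < T /\ Dt p.2 p.1].

Definition ST : set ('rV[R]_N * R) :=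
  [set p | 0 < p.2 < T /\ frontier (Dt p.2) p.1].

(* m - grad s, the gradient of x |-> x . m - s(x', t): an upward normal vector
   to the graph of s(., t), of Euclidean length sqrt (1 + |grad s|^2).  The rows
   of E carry the tangential gradient back to R^N. *)
Definition upward_normal (s : 'rV[R]_(N.-1) * R -> R) (p : 'rV[R]_N * R) :=
  let v := grad s (tcoord m E p.1, p.2) in
  (Num.sqrt (1 + dot v v))^-1 *: (m - v *m E).

(* The exterior unit normal of D(t) points upward on the upper graph and
   downward on the lower one (frontier points lie on exactly one of them). *)
Definition exterior_normal (p : 'rV[R]_N * R) : 'rV[R]_N :=
  if dot p.1 m == sp (tcoord m E p.1, p.2) then upward_normal sp p
  else - upward_normal sm p.

End MovingDomain.

(* Regularity of one of the two sheets of the free boundary, and its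
   convergence to the initial sheet. *)
Definition admissible_sheet (s : 'rV[R]_(N.-1) * R -> R)
    (s0 : 'rV[R]_(N.-1) -> R) := [/\
  C21_on (spacetime 0 T) s,
  forall e : R, 0 < e -> exists M : R, forall p, spacetime e T p -> [/\
      `|pdt s p| <= M,
      forall i, `|pdx i s p| <= M &
      forall i j, `|pdx j (pdx i s) p| <= M] &
  C2_uniform_limit0 s s0].

(* u together with the two sheets s-, s+ solves u_t - Delta u = f in Q_T,
   u = 0 and du/dnu = - alpha on S_T.  The gradient is continuous up to S_T:
   du/dnu there refers to its continuous extension G. *)
Definition classical_solution (alpha : R) (f : 'rV[R]_N * R -> R)
    (u : 'rV[R]_N * R -> R) (sm sp : 'rV[R]_(N.-1) * R -> R) :=
  let Q := QT sm sp in let S := ST sm sp in [/\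
    C21_on Q u,
    {within Q `|` S, continuous u},
    forall p, (Q `|` S) p -> 0 <= u p,
    forall p, Q p -> pdt u p - laplacian u p = f p &
    (forall p, S p -> u p = 0) /\
    exists G : 'rV[R]_N * R -> 'rV[R]_N, [/\
      {within Q `|` S, continuous G},
      forall p, Q p -> G p = grad u p &
      forall p, S p -> dot (G p) (exterior_normal sm sp p) = - alpha]].

(* Solution on (0, T) with initial data u0 and S_0, the boundary of
   graph_domain m E s0m s0p. *)
Definition ivp_solution (alpha : R) (f : 'rV[R]_N * R -> R)
    (u0 : 'rV[R]_N -> R) (s0m s0p : 'rV[R]_(N.-1) -> R)
    (u : 'rV[R]_N * R -> R) (sm sp : 'rV[R]_(N.-1) * R -> R) :=
  let QS := QT sm sp `|` ST sm sp in [/\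
    admissible_sheet sm s0m /\ admissible_sheet sp s0p,
    forall p, spacetime 0 T p -> sm p < sp p,
    classical_solution alpha f u sm sp,
    exists M : R, forall p, QS p -> `|u p| <= M &
    {within QS `|` (closure (graph_domain m E s0m s0p) `*` [set 0]),
      continuous (fun p => if p.2 == 0 then u0 p.1 else u p)}].

End FreeBoundaryProblem.

(* Main.v *)
Require Import Defs.
From mathcomp Require Import ring lra.

Set Implicit Arguments.
Unset Strict Implicit.
Unset Printing Implicit Defensive.

Import Order.TTheory GRing.Theory Num.Theory.
Import numFieldNormedType.Exports.

Local Open Scope classical_set_scope.
Local Open Scope ring_scope.

(** A thin layer of solution cannot carry the slope alpha without being swept
    away at once.  Let K > 0 bound f.  Since u starts from zero and vanishes on
    the free boundary, comparison with K t gives u <= K t ([linear_growth]).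

    A front that carries the slope b and recedes with speed c supports a layer
    of height about b / c only; so, as long as u <= K t1, a barrier with slope
    b < alpha at its edge can recede with a speed of order b / (K t1) and still
    stay above u.  Over the time t1 it then covers a distance of order b / K,
    which does not shrink with t1.

    The receding edge is chosen to be a sphere that grows into the domain from
    outside.  Its centre c0 lies above the upper sheet, its squared radius
    increases linearly in time, from a value just below the squared distance of
    c0 to the initial domain to a value just above.  The barrier is
      w = b q - a q^2,   q (x, t) = |x - c0|^2 - xi - c t,
    on the layer 0 <= q <= b / (2 a).  The ball q < 0 never enters D(t)
    ([no_invasion]): at the first contact the contact point lies on S(t), the
    comparison principle gives u <= w up to this time, both vanish at the
    contact point, and so alpha is at most the slope 2 b |x - c0| of w there,
    while b was taken too small for this.

    On the other hand a point of the initial domain that lies in the final ball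
    stays in D(t) for small t, because S(t) tends to the initial boundary.  As
    the final time t1 can be taken arbitrarily small while the distance covered
    stays fixed, this is a contradiction ([no_thin_start]).

    Only the comparison on a compact set is needed, which rests on the maximum
    principle at an interior point ([no_interior_max], [comparison]).  The
    moving domain enters through one continuous function Phi, positive inside
    and zero on the sheets, defined down to t = 0 by extending the sheets with
    their initial values ([thickness], [extend_sheet]). *)

(** * Limits along slices and lines *)

Section Closed.
Context {R : realType} {T : topologicalType}.

Lemma closed_sublevel (F : T -> R) (l : R) :
  continuous F -> closed [set p | F p <= l].
Proof. by move=> /continuous_closedP /(_ _ (@closed_le _ l)). Qed.

Lemma closed_superlevel (F : T -> R) (l : R) :
  continuous F -> closed [set p | l <= F p].
Proof. by move=> /continuous_closedP /(_ _ (@closed_ge _ l)). Qed.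

Lemma near_superlevel (F : T -> R) (l : R) (p : T) :
  continuous F -> l < F p -> \forall q \near p, l < F q.
Proof. by move=> cF lF; exact: (cF p _ (lt_nbhsr lF)). Qed.

End Closed.

Section Near.
Context {R : realType} {N : nat}.
Implicit Types (x v : 'rV[R]_N) (t : R).

Lemma continuous_slice_space x t : (fun y : 'rV[R]_N => (y, t)) @ x --> (x, t).
Proof.
apply: (@cvg_pair _ _ _ _ _ _ (nbhs_filter x) (nbhs_filter x) (nbhs_filter t)).
  exact: cvg_id.
exact: (@cvg_cst _ _ _ _ (nbhs_filter x)).
Qed.

Lemma continuous_slice_time x t : (fun s : R => (x, s)) @ t --> (x, t).
Proof.
apply: (@cvg_pair _ _ _ _ _ _ (nbhs_filter t) (nbhs_filter x) (nbhs_filter t)).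
  exact: (@cvg_cst _ _ _ _ (nbhs_filter t)).
exact: cvg_id.
Qed.

Lemma continuous_line x v : continuous (fun h : R => x + h *: v).
Proof.
move=> h; apply: cvgD; first exact: cvg_cst.
by apply: cvgZr_tmp; exact: cvg_id.
Qed.

Lemma near_line x v (P : 'rV[R]_N -> Prop) :
  (\forall y \near x, P y) -> \forall h \near (0 : R), P (x + h *: v).
Proof.
have := @continuous_line x v 0; rewrite /continuous_at scale0r addr0 => cl.
exact: cl.
Qed.

Lemma near_ray x v (P : 'rV[R]_N -> Prop) :
  (\forall y \near x, P y) -> \forall h \near (0 : R)^'+, P (x + h *: v).
Proof.
by move=> nP; apply: (@cvg_within _ (nbhs (0 : R))); exact: near_line.
Qed.

End Near.

Lemma within_continuous_at (T U : topologicalType) (A : set T) (f : T -> U)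
    (p : T) :
  {within A, continuous f} -> (\forall z \near p, A z) -> {for p, continuous f}.
Proof.
move=> /subspace_continuousP cf nA W /= fW.
have Wf := cf p (nbhs_singleton nA) W fW.
by apply: filterS (filterI nA Wf) => z [Az]; exact.
Qed.

Lemma mxnorm_lt_coord (R : realType) n (y : 'rV[R]_n) (d : R) : 0 < d ->
  (forall j, `|y 0 j| < d) -> `|y| < d.
Proof.
move=> d0 H; rewrite [ltLHS]/Num.norm /= mx_normrE; apply/bigmax_ltP.
by split => //= -[i j] _; rewrite /= ord1.
Qed.

Lemma le_coord_mxnorm (R : realType) n (y : 'rV[R]_n) j : `|y 0 j| <= `|y|.
Proof.
rewrite [leRHS]/Num.norm /= mx_normrE.
by apply: (@le_bigmax _ _ _ _ (fun i : 'I_1 * 'I_n => `|y i.1 i.2|) (0, j)).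
Qed.

Lemma continuous_rV (R : realType) (T : topologicalType) (N : nat)
    (F : T -> 'rV[R]_N) :
  (forall i, continuous (fun p => F p 0 i)) -> continuous F.
Proof.
move=> cF p; apply/cvgrPdist_lt => e e0.
have : \forall z \near p, forall i, `|F p 0 i - F z 0 i| < e.
  apply: (filter_forall (nbhs_filter p)) => i.
  by have /cvgrPdist_lt := cF i p; apply.
apply: filterS => z Hz; apply: mxnorm_lt_coord => // i.
by rewrite !mxE.
Qed.

(** * Calculus at a maximum, and directional derivatives *)

Lemma left_max_derive1_ge0 (R : realType) (k : R -> R) (t : R) :
  derivable k t 1 -> (\forall s \near t^'-, k s <= k t) -> 0 <= derive1 k t.
Proof.
move=> dk kmax; rewrite derive1E ['D_1 k t]cvg_at_leftE//.
apply: limr_ge.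
  rewrite -(cvg_at_leftE (fun h => h^-1 *: ((k \o shift t) _ - k t))) //.
  apply: cvg_trans dk; apply: cvg_app => A [e egt0 Ae].
  by exists e => // x xe xgt0; apply: Ae => //; exact/ltr0_neq0.
case: kmax => e /= e0 he; near=> h.
have h0 : h < 0 by near: h; exists 1 => /=.
have he' : `|h| < e.
  by near: h; exists e => //= z; rewrite /= sub0r normrN.
apply: mulr_le0; first by rewrite invr_le0 ltW.
rewrite subr_le0 [_%:A]mulr1; apply: he; last by rewrite gtrDr.
by rewrite /ball_/= opprD addrCA subrr addr0 normrN.
Unshelve. all: by end_near. Qed.

Lemma right_increase (R : realType) (k : R -> R) (d : R) :
  is_derive (0 : R) (1 : R) k d -> 0 < d -> \forall h \near (0 : R)^'+, k 0 < k h.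
Proof.
move=> dk d0.
have dv := @derive_val _ _ _ _ _ _ _ dk; have ed := @ex_derive _ _ _ _ _ _ _ dk.
have : (fun h => h^-1 *: (k (h%:A + 0) - k 0)) @ 0^' --> d by rewrite -dv.
move=> /(_ _ (lt_nbhsr d0)) [e /= e0 he]; exists e => // h /= he' h0.
have := he h he'; rewrite gt_eqF// => /(_ isT).
by rewrite addr0 [_%:A]mulr1 pmulr_rgt0 ?invr_gt0// subr_gt0.
Qed.

(** Were the second derivative c positive, k1 would be positive just to the right
    of its zero 0, and k would increase there by the mean value theorem.  Only
    differentiability of k1 at the single point 0 is available. *)
Lemma max_second_derivative_le0 (R : realType) (k k1 : R -> R) (c : R) :
  (\forall h \near (0 : R), is_derive (h : R) (1 : R) k (k1 h)) -> is_derive (0 : R) 1 k1 c ->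
  (\forall h \near (0 : R), k h <= k 0) -> c <= 0.
Proof.
move=> dk dk1 kmax; rewrite leNgt; apply/negP => c0.
have [e e0 he] : exists2 e : R, 0 < e &
    forall h, `|h| < e -> is_derive (h : R) (1 : R) k (k1 h) /\ k h <= k 0.
  have := filterI dk kmax; case=> e /= e0 he; exists e => // h hh.
  by apply: he; rewrite /= sub0r normrN.
have itvE (h : R) : h \in `](- e), e[%R -> `|h| < e.
  by rewrite in_itv/= ltr_norml.
have k10 : k1 0 = 0.
  have z0 : (0 : R) \in `](- e), e[%R by rewrite in_itv/= oppr_lt0 e0.
  have : is_derive (0:R) 1 k 0.
    apply: (@derive1_at_max _ k (- e) e 0) => //; first lra.
      by move=> t /itvE/he[dt _]; exact: ex_derive.
    by move=> t /itvE/he[].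
  move=> D; have [D' _] := he 0 (itvE _ z0).
  by rewrite -(@derive_val _ _ _ _ _ _ _ D') (@derive_val _ _ _ _ _ _ _ D).
have [d d0 hd] : exists2 d : R, 0 < d & forall h, 0 < h < d -> 0 < k1 h.
  have [d /= d0 hd] := right_increase dk1 c0; exists d => // h /andP[h0 hd'].
  by have := hd h; rewrite /= sub0r normrN gtr0_norm// k10; apply.
set b := Num.min e d / 2.
have b0 : 0 < b by rewrite /b divr_gt0// lt_min e0.
have be : b < e by rewrite /b ltr_pdivrMr// gt_min ltr_pMr// ltr1n.
have bd : b < d by rewrite /b ltr_pdivrMr// gt_min (ltr_pMr _ d0) ltr1n orbT.
have [||x] := @MVT _ k k1 0 b b0.
- by move=> x; rewrite in_itv/= => /andP[x0 xb]; apply: (he x _).1; rewrite gtr0_norm//; lra.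
- apply: derivable_within_continuous => x; rewrite in_itv/= => /andP[x0 xb].
  have xe : `|x| < e by rewrite ger0_norm//; lra.
  by have [D _] := he x xe; exact: ex_derive.
rewrite in_itv/= subr0 => /andP[x0 xb] eq.
have [_ kb] : is_derive (b : R) (1 : R) k (k1 b) /\ k b <= k 0.
  by apply: he; rewrite gtr0_norm.
have := hd x; rewrite x0 (lt_trans xb bd) => /(_ isT) k1x.
have : 0 < k b - k 0 by rewrite eq mulr_gt0.
by rewrite subr_gt0 ltNge kb.
Qed.

Lemma is_derive_horner (R : realType) (P : {poly R}) (k : R -> R) (t d : R) :
  k =1 horner P -> (P^`()%R).[t] = d -> is_derive t (1 : R) k d.
Proof. by move=> /funext -> <-; exact: is_derive_poly. Qed.

Lemma is_derive_line (R : realType) (V : normedModType R) (g : V -> R)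
    (a v : V) (t d : R) :
  is_derive (a + t *: v) v g d -> is_derive t 1 (fun s => g (a + s *: v)) d.
Proof.
have E : (fun h => h^-1 *: (g (a + (h *: (1 : R) + t) *: v) - g (a + t *: v))) =
    (fun h => h^-1 *: (g (h *: v + (a + t *: v)) - g (a + t *: v))).
  by apply/funext => h; rewrite [h *: 1]mulr1 scalerDl addrCA.
move=> D; split.
- by rewrite /derivable /= E; exact: ex_derive.
- rewrite [LHS]/derive /= E; exact: derive_val.
Qed.

Lemma partial_mean_value (R : realType) (n : nat) (g : 'rV[R]_n -> R)
    (z : 'rV[R]_n) (i : 'I_n) (h : R) :
  (forall s : R, `|s| <= `|h| -> derivable g (z + s *: evec i) (evec i)) ->
  exists2 s : R, `|s| <= `|h| &
    g (z + h *: evec i) - g z = h * pd i g (z + s *: evec i).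
Proof.
move=> dg.
have D (s : R) : `|s| <= `|h| ->
    is_derive s (1 : R) (fun s => g (z + s *: evec i)) (pd i g (z + s *: evec i)).
  by move=> sh; apply: is_derive_line; apply: derivableP; exact: dg.
have g0 : g z = g (z + 0 *: evec i) by rewrite scale0r addr0.
have [h0|h0|->] := ltgtP h 0; last by exists 0; rewrite ?normr0// scale0r addr0 subrr mul0r.
- have [||s] := @MVT_segment _ (fun s => g (z + s *: evec i)) (fun s => pd i g (z + s *: evec i)) h 0 (ltW h0).
  + move=> x; rewrite in_itv/= => /andP[? ?]; apply: D.
    by rewrite !ltr0_norm//; lra.
  + apply: derivable_within_continuous => x; rewrite in_itv/= => /andP[? ?].
    have xh : `|x| <= `|h| by rewrite !ler0_norm ?(ltW h0)//; lra.
    have dx := D x xh; exact: (@ex_derive _ _ _ _ _ _ _ dx).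
  + rewrite in_itv/= => /andP[? ?]; rewrite -g0 sub0r => eq.
    by exists s; [rewrite !ler0_norm//; lra|lra].
- have [||s] := @MVT_segment _ (fun s => g (z + s *: evec i)) (fun s => pd i g (z + s *: evec i)) 0 h (ltW h0).
  + move=> x; rewrite in_itv/= => /andP[? ?]; apply: D.
    by rewrite !gtr0_norm//; lra.
  + apply: derivable_within_continuous => x; rewrite in_itv/= => /andP[? ?].
    have xh : `|x| <= `|h| by rewrite !ger0_norm ?(ltW h0)//; lra.
    have dx := D x xh; exact: (@ex_derive _ _ _ _ _ _ _ dx).
  + rewrite in_itv/= => /andP[? ?]; rewrite -g0 subr0 => eq.
    by exists s; [rewrite !ger0_norm//; lra|lra].
Qed.

(** Going from x to x + h along the coordinate directions one at a time, each step
    is governed by one partial derivative at a point close to x.  The error is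
    measured by the sum of the |h_i| to avoid constants depending on n. *)
Lemma partials_linear_approx (R : realType) (n : nat) (g : 'rV[R]_n -> R)
    (x : 'rV[R]_n) :
  (\forall y \near x, forall i, derivable g y (evec i)) ->
  (forall i, {for x, continuous (pd i g)}) ->
  forall e : R, 0 < e -> \forall h \near (0 : 'rV[R]_n),
    `|g (x + h) - g x - \sum_i h 0 i * pd i g x| <= e * \sum_i `|h 0 i|.
Proof.
move=> dg cg e e0.
have [d d0 hd] : exists2 d : R, 0 < d & forall y, `|y - x| < d ->
    forall i, derivable g y (evec i) /\ `|pd i g y - pd i g x| < e.
  have cg' : \forall y \near x, forall i, `|pd i g x - pd i g y| < e.
    apply: (filter_forall (nbhs_filter x)) => i; have := cg i.
    by move=> /cvgrPdist_lt; apply.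
  have /nbhs_ballP[d /= d0] := @filterI _ _ (nbhs_filter x) _ _ dg cg'.
  rewrite -ball_normE/= => hd; exists d => // y yx i.
  have [] := hd y; first by rewrite /= -normrN opprB.
  by move=> A /(_ i); rewrite distrC.
apply/nbhs_ballP; exists d => //= h; rewrite -ball_normE/= sub0r normrN => hdl.
(* the corners of the path: the first k coordinates of h are in place *)
pose tr k : 'rV[R]_n := \row_i (if (i < k)%N then h 0 i else 0).
have trS (k : 'I_n) : tr k.+1 = tr k + h 0 k *: evec k.
  apply/rowP => j; rewrite /evec !mxE /= ?eqxx/= ltnS leq_eqVlt.
  have [->|jk] := eqVneq j k; first by rewrite eqxx ltnn/= mulr1 add0r.
  by rewrite -val_eqE/= in jk *; rewrite (negbTE jk)/= mulr0 addr0.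
have tr0 : tr 0%N = 0 by apply/rowP => j; rewrite !mxE.
have trn : tr n = h by apply/rowP => j; rewrite !mxE ltn_ord.
have step (k : 'I_n) :
    `|g (x + tr k.+1) - g (x + tr k) - h 0 k * pd k g x| <= e * `|h 0 k|.
  have near_x s : `|s| <= `|h 0 k| -> `|x + tr k + s *: evec k - x| < d.
    move=> sh; rewrite addrAC [x + _]addrC addrK.
    apply: mxnorm_lt_coord => // j; rewrite /evec !mxE /= ?eqxx/=.
    apply: le_lt_trans hdl; have [->|jk] := eqVneq j k.
      by rewrite ltnn add0r mulr1; apply: le_trans sh (le_coord_mxnorm _ _).
    by rewrite mulr0 addr0; case: ifP => // _; rewrite ?normr0// le_coord_mxnorm.
  have [s sh mv] : exists2 s : R, `|s| <= `|h 0 k| &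
    g (x + tr k + h 0 k *: evec k) - g (x + tr k) = h 0 k * pd k g (x + tr k + s *: evec k).
    by apply: partial_mean_value => s sh; apply: (hd _ _ k).1; exact: near_x.
  rewrite trS addrA mv -mulrBr normrM mulrC ler_wpM2r//.
  by apply: ltW; apply: (hd _ _ k).2; exact: near_x.
have -> : g (x + h) - g x - \sum_i h 0 i * pd i g x =
   \sum_(i < n) (g (x + tr i.+1) - g (x + tr i) - h 0 i * pd i g x).
  rewrite sumrB; congr (_ - _).
  rewrite -(big_mkord xpredT (fun k => g (x + tr k.+1) - g (x + tr k))).
  by rewrite telescope_sumr// trn tr0 addr0.
by rewrite mulr_sumr; apply: le_trans (ler_norm_sum _ _ _) _; apply: ler_sum.
Qed.

(** The normal directions of the free boundary are not coordinate directions;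
    this turns coordinate partials into the derivative along any vector. *)
Lemma is_derive_partials (R : realType) (n : nat) (g : 'rV[R]_n -> R)
    (x v : 'rV[R]_n) :
  (\forall y \near x, forall i, derivable g y (evec i)) ->
  (forall i, {for x, continuous (pd i g)}) ->
  is_derive x v g (\sum_i v 0 i * pd i g x).
Proof.
move=> dg cg.
suff C : (fun h => h^-1 *: (g (h *: v + x) - g x)) @ 0^' -->
    (\sum_i v 0 i * pd i g x : R).
  split; first by apply/cvg_ex; eexists; exact: C.
  exact: cvg_lim.
apply/cvgrPdist_le => /= e e0.
pose s := 1 + \sum_i `|v 0 i|.
have s0 : 0 < s by rewrite ltr_pwDl// sumr_ge0.
have := partials_linear_approx dg cg (divr_gt0 e0 s0).
case/nbhs_ballP => d /= d0; rewrite -ball_normE/= => hd.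
have v0 : 0 < 1 + `|v| by rewrite ltr_pwDl.
near=> h.
have h0 : h != 0 by near: h; exact: nbhs_dnbhs_neq.
have hs : `|h *: v| < d.
  rewrite normrZ; apply: (@le_lt_trans _ _ (`|h| * (1 + `|v|))).
    by rewrite ler_wpM2l// lerDr.
  rewrite -ltr_pdivlMr//; near: h; exists (d / (1 + `|v|)) => /=.
    by rewrite divr_gt0.
  by move=> z; rewrite /= sub0r normrN.
have := hd (h *: v); rewrite /= sub0r normrN => /(_ hs).
have -> : \sum_i (h *: v) 0 i * pd i g x = h * \sum_i v 0 i * pd i g x.
  by rewrite mulr_sumr; apply: eq_bigr => i _; rewrite mxE mulrA.
have -> : \sum_i `|(h *: v) 0 i| = `|h| * \sum_i `|v 0 i|.
  by rewrite mulr_sumr; apply: eq_bigr => i _; rewrite mxE normrM.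
rewrite [x + _]addrC; set D := \sum_i _; set w := \sum_i _ => H.
have hn0 : 0 < `|h| by rewrite normr_gt0.
rewrite distrC -(ler_pM2l hn0) -normrM mulrBr.
rewrite [h^-1 *: _]/(h^-1 * _) mulVKf//.
apply: le_trans H _; rewrite mulrCA ler_pM2l//.
by rewrite mulrAC ler_pdivrMr// ler_pM2l// lerDr.
Unshelve. all: by end_near. Qed.

(** * The Euclidean product *)

Section Dot.
Context {R : realType} {N : nat}.
Implicit Types (x y z : 'rV[R]_N).

Lemma dotC x y : dot x y = dot y x.
Proof. by apply: eq_bigr => i _; rewrite mulrC. Qed.

Lemma dotDl x y z : dot (x + y) z = dot x z + dot y z.
Proof. by rewrite -big_split; apply: eq_bigr => i _; rewrite mxE mulrDl. Qed.

Lemma dotZl a x y : dot (a *: x) y = a * dot x y.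
Proof. by rewrite mulr_sumr; apply: eq_bigr => i _; rewrite mxE mulrA. Qed.

Lemma dotNl x y : dot (- x) y = - dot x y.
Proof. by rewrite -scaleN1r dotZl mulN1r. Qed.

Lemma dotDr x y z : dot x (y + z) = dot x y + dot x z.
Proof. by rewrite dotC dotDl !(dotC x). Qed.

Lemma dotZr a x y : dot x (a *: y) = a * dot x y.
Proof. by rewrite dotC dotZl (dotC x). Qed.

Lemma dotNr x y : dot x (- y) = - dot x y.
Proof. by rewrite dotC dotNl (dotC x). Qed.

Lemma dot_evec x i : dot x (evec i) = x 0 i.
Proof.
rewrite /dot (bigD1 i)//= big1 => [|j ji].
  by rewrite /evec mxE !eqxx mulr1 addr0.
by rewrite /evec mxE (negbTE ji) andbF mulr0.
Qed.

Lemma dot_ge0 x : 0 <= dot x x.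
Proof. by apply: sumr_ge0 => i _; rewrite -expr2 sqr_ge0. Qed.

Lemma sqr_coord_le_dot x i : x 0 i ^+ 2 <= dot x x.
Proof.
rewrite /dot (bigD1 i)//= expr2 lerDl.
by apply: sumr_ge0 => j _; rewrite -expr2 sqr_ge0.
Qed.

Lemma continuous_dot (T : topologicalType) (F G : T -> 'rV[R]_N) :
  continuous F -> continuous G -> continuous (fun p => dot (F p) (G p)).
Proof.
move=> cF cG; apply: continuous_big; first exact: add_continuous.
move=> i _ p; apply: continuousM.
  apply: (@continuous_comp _ _ _ F (fun x : 'rV[R]_N => x 0 i)); first exact: cF.
  exact: coord_continuous.
apply: (@continuous_comp _ _ _ G (fun x : 'rV[R]_N => x 0 i)); first exact: cG.
exact: coord_continuous.
Qed.

End Dot.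

(** * The paraboloidal barrier and the interior maximum principle *)

Section Barrier.
Context {R : realType} {N : nat}.
Variables (c0 : 'rV[R]_N) (xi c b a : R).

(** The edge q = 0 of the barrier is a sphere around c0 whose squared radius
    xi + c t depends linearly on t: this keeps the barrier polynomial, and with
    a = 0 the same family contains the functions lam |x|^2 + const * t. *)
Definition front (p : 'rV[R]_N * R) : R :=
  dot (p.1 - c0) (p.1 - c0) - xi - c * p.2.

Definition barrier (p : 'rV[R]_N * R) : R := b * front p - a * front p ^+ 2.

Lemma continuous_front : continuous front.
Proof.
have c1 : continuous (fun p : 'rV[R]_N * R => p.1 - c0).
  move=> p; apply: cvgB; [exact: cvg_fst|exact: cvg_cst].
move=> p; apply: cvgB; last by apply: cvgM; [exact: cvg_cst|exact: cvg_snd].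
by apply: cvgB; [exact: (continuous_dot c1 c1)|exact: cvg_cst].
Qed.

Lemma continuous_barrier : continuous barrier.
Proof.
have cf := continuous_front.
move=> p; apply: cvgB; first by apply: cvgM; [exact: cvg_cst|exact: cf].
apply: cvgM; first exact: cvg_cst.
by rewrite expr2; apply: cvgM; exact: cf.
Qed.

Lemma front_coord (x : 'rV[R]_N) t (i : 'I_N) (h : R) :
  front (x + h *: evec i, t) = front (x, t) + 2 * h * (x - c0) 0 i + h ^+ 2.
Proof.
rewrite /front/= addrAC !(dotDl, dotDr, dotZl, dotZr, dotNl, dotNr).
rewrite !(dotC (evec i)) !dot_evec /evec !mxE !eqxx/=; ring.
Qed.

Lemma is_derive_barrier_time (x : 'rV[R]_N) (t : R) :
  is_derive t (1 : R) (fun s => barrier (x, s)) (- c * (b - 2 * a * front (x, t))).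
Proof.
pose Q : {poly R} := (dot (x - c0) (x - c0) - xi)%:P - c *: 'X.
apply: (@is_derive_horner _ (b *: Q - a *: Q ^+ 2)).
  by move=> s; rewrite /barrier /front /Q !hornerE/=; ring.
by rewrite /Q /front !poly.derivE !hornerE/=; ring.
Qed.

Let barrier_coord1 (x : 'rV[R]_N) t (i : 'I_N) (h : R) : R :=
  (b - 2 * a * front (x + h *: evec i, t)) * (2 * (x - c0) 0 i + 2 * h).

Lemma is_derive_barrier_coord (x : 'rV[R]_N) (t h : R) (i : 'I_N) :
  is_derive h (1 : R) (fun s => barrier (x + s *: evec i, t))
    (barrier_coord1 x t i h).
Proof.
pose Q : {poly R} := (front (x, t))%:P + (2 * (x - c0) 0 i) *: 'X + 'X ^+ 2.
apply: (@is_derive_horner _ (b *: Q - a *: Q ^+ 2)).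
  by move=> s; rewrite /barrier front_coord /Q !hornerE/=; ring.
by rewrite /barrier_coord1 front_coord /Q !poly.derivE !hornerE/=; ring.
Qed.

Lemma is_derive_barrier_coord2 (x : 'rV[R]_N) (t : R) (i : 'I_N) :
  is_derive (0 : R) (1 : R) (barrier_coord1 x t i)
    (2 * (b - 2 * a * front (x, t)) - 8 * a * (x - c0) 0 i ^+ 2).
Proof.
pose Q : {poly R} := (front (x, t))%:P + (2 * (x - c0) 0 i) *: 'X + 'X ^+ 2.
pose L : {poly R} := (2 * (x - c0) 0 i)%:P + 2 *: 'X.
apply: (@is_derive_horner _ ((b%:P - (2 * a) *: Q) * L)).
  by move=> s; rewrite /barrier_coord1 front_coord /Q /L !hornerE/=; ring.
by rewrite /Q /L !poly.derivE !hornerE/=; ring.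
Qed.

(** The barrier w has time derivative - c (b - 2 a q) and Laplacian
    2 N (b - 2 a q) - 8 a |x - c0|^2, so K is strictly below its heat operator.  A
    maximum over past times only is enough, since it still bounds the time
    derivative of u - w from below. *)
Lemma no_interior_max (u : 'rV[R]_N * R -> R) (K : R) (p : 'rV[R]_N * R) :
  derivable (fun t => u (p.1, t)) p.2 1 ->
  (\forall y \near p.1, forall i, derivable (at_time u p.2) y (evec i)) ->
  (forall i, derivable (at_time (pdx i u) p.2) p.1 (evec i)) ->
  pdt u p - laplacian u p <= K ->
  K < - (c + 2 * N%:R) * (b - 2 * a * front p)
      + 8 * a * dot (p.1 - c0) (p.1 - c0) ->
  (\forall s \near p.2^'-, u (p.1, s) - barrier (p.1, s) <= u p - barrier p) ->
  (\forall y \near p.1, u (y, p.2) - barrier (y, p.2) <= u p - barrier p) ->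
  False.
Proof.
case: p => x t /= dt dx dxx eqn sup tmax xmax.
have ut : - c * (b - 2 * a * front (x, t)) <= pdt u (x, t).
  have db := is_derive_barrier_time x t.
  have D : is_derive t (1 : R) (fun s => u (x, s) - barrier (x, s))
      (pdt u (x, t) - (- c * (b - 2 * a * front (x, t)))).
    by apply: is_deriveB db; rewrite /pdt derive1E; exact: derivableP.
  have := left_max_derive1_ge0 (@ex_derive _ _ _ _ _ _ _ D) tmax.
  by rewrite derive1E (@derive_val _ _ _ _ _ _ _ D) subr_ge0.
have uxx i : pdx i (pdx i u) (x, t) <=
    2 * (b - 2 * a * front (x, t)) - 8 * a * (x - c0) 0 i ^+ 2.
  rewrite -subr_le0.
  apply: (@max_second_derivative_le0 _
    (fun h => u (x + h *: evec i, t) - barrier (x + h *: evec i, t))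
    (fun h => pdx i u (x + h *: evec i, t) - barrier_coord1 x t i h)).
  - apply: filterS (near_line (evec i) dx) => h dh.
    apply: is_deriveB; last exact: is_derive_barrier_coord.
    by apply: (@is_derive_line _ _ (at_time u t)); apply: derivableP; exact: dh.
  - apply: is_deriveB; last exact: is_derive_barrier_coord2.
    apply: (@is_derive_line _ _ (at_time (pdx i u) t)).
    rewrite scale0r addr0; apply: derivableP; exact: dxx.
  - by apply: filterS (near_line (evec i) xmax) => h; rewrite scale0r addr0.
have lap : laplacian u (x, t) <= 2 * N%:R * (b - 2 * a * front (x, t))
    - 8 * a * dot (x - c0) (x - c0).
  apply: le_trans (ler_sum _ (fun i _ => uxx i)) _.
  have -> : dot (x - c0) (x - c0) = \sum_i (x - c0) 0 i ^+ 2.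
    by apply: eq_bigr => i _; rewrite expr2.
  by rewrite sumrB sumr_const card_ord -mulr_sumr -mulr_natr [leRHS]addrC; lra.
move: eqn sup ut lap; lra.
Qed.

End Barrier.

(** * Comparison on moving domains *)

(** The region swept by the closures of the domains up to time t1.  The moving
    domain is represented by one function Phi, positive inside and zero on the
    boundary; the initial time belongs to the region, so that it is closed. *)
Definition swept (R : realType) (N : nat) (Phi : 'rV[R]_N * R -> R) (t1 : R) :
    set ('rV[R]_N * R) :=
  [set p | 0 <= p.2 <= t1 /\ 0 <= Phi p].

Definition swept_interior (R : realType) (N : nat) (Phi : 'rV[R]_N * R -> R)
    (t1 : R) : set ('rV[R]_N * R) :=
  [set p | 0 < p.2 <= t1 /\ 0 < Phi p].

Definition zero_initial (R : realType) (N : nat) (u : 'rV[R]_N * R -> R) :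
    'rV[R]_N * R -> R := fun p => if p.2 == 0 then 0 else u p.

(** What the comparison arguments use of a solution.  The derivatives are those
    of u and not of [zero_initial u], as they are only taken at positive times. *)
Record moving_subsolution (R : realType) (N : nat) (Phi : 'rV[R]_N * R -> R)
    (t1 K : R) (u : 'rV[R]_N * R -> R) : Prop := MovingSubsolution {
  ms_Phi : continuous Phi ;
  ms_u : {within swept Phi t1, continuous (zero_initial u)} ;
  ms_boundary : forall p, swept Phi t1 p -> 0 < p.2 -> Phi p = 0 -> u p = 0 ;
  ms_dt : forall p, swept_interior Phi t1 p -> derivable (fun t => u (p.1, t)) p.2 1 ;
  ms_dx : forall p, swept_interior Phi t1 p ->
    forall i, derivable (at_time u p.2) p.1 (evec i) ;
  ms_dxx : forall p, swept_interior Phi t1 p ->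
    forall i, derivable (at_time (pdx i u) p.2) p.1 (evec i) ;
  ms_eqn : forall p, swept_interior Phi t1 p -> pdt u p - laplacian u p <= K
}.

Lemma le_one_sqr (R : realType) (y : R) : `|y| <= 1 + y ^+ 2.
Proof.
rewrite -(real_normK (num_real y)); have := sqr_ge0 (`|y| - 1 : R).
have := normr_ge0 y; nra.
Qed.

Section Swept.
Context {R : realType} {N : nat}.
Variables (Phi : 'rV[R]_N * R -> R) (t1 : R).
Hypothesis cPhi : continuous Phi.

(** The sublevel sets of q cut bounded pieces out of an unbounded domain: this is
    how compactness enters, and why q grows quadratically. *)
Lemma compact_swept_front (c0 : 'rV[R]_N) (xi c l : R) :
  compact (swept Phi t1 `&` [set p | front c0 xi c p <= l]).
Proof.
have cf := @continuous_front R N c0 xi c.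
pose L := 1 + (l + xi + `|c| * t1).
apply: (@subclosed_compact _ _
  ([set x : 'rV[R]_N | forall i, x 0 i \in `[c0 0 i - L, c0 0 i + L]] `*`
   [set t : R | t \in `[0, t1]])).
- apply: closedI; last exact: closed_sublevel.
  have -> : swept Phi t1 = [set p | 0 <= p.2] `&` [set p | p.2 <= t1] `&` [set p | 0 <= Phi p].
    apply/seteqP; split=> [p [/andP[? ?] ?]|p [[? ?] ?]] //.
    by split => //; apply/andP.
  have c2 : continuous (fun p : 'rV[R]_N * R => p.2) by move=> p; exact: cvg_snd.
  by apply: closedI; [apply: closedI|]; [exact: closed_superlevel|exact: closed_sublevel|exact: closed_superlevel].
- apply: compact_setX; last exact: segment_compact.
  apply: (@rV_compact _ _ (fun i => [set y | y \in `[c0 0 i - L, c0 0 i + L]])).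
  by move=> i; exact: segment_compact.
- move=> [x t] /= [[/= /andP[t0 tt1] _]]; rewrite /front/= => ql.
  split => /=; last by rewrite in_itv/= t0.
  move=> i; rewrite in_itv/= -ler_distlC.
  have := sqr_coord_le_dot (x - c0) i; have := le_one_sqr ((x - c0) 0 i).
  rewrite distrC !mxE => A B.
  have : c * t <= `|c| * t1.
    by apply: le_trans (ler_norm _) _; rewrite normrM (ger0_norm t0) ler_wpM2l.
  by rewrite /L; lra.
Qed.

(** A positive maximum of u - w over the compact piece q <= l can only occur where
    u > 0, t > 0 and q < l, that is at an interior point, against
    [no_interior_max].  The bound w >= 0 stands for the comparison on the moving
    boundary and at the initial time, where u = 0. *)
Lemma comparison (K : R) (u : 'rV[R]_N * R -> R)
    (c0 : 'rV[R]_N) (xi c b a l : R) :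
  moving_subsolution Phi t1 K u ->
  (forall p, swept Phi t1 p -> front c0 xi c p <= l -> 0 <= barrier c0 xi c b a p) ->
  (forall p, swept_interior Phi t1 p -> front c0 xi c p = l ->
     u p <= barrier c0 xi c b a p) ->
  (forall p, swept_interior Phi t1 p -> front c0 xi c p < l ->
     K < - (c + 2 * N%:R) * (b - 2 * a * front c0 xi c p)
      + 8 * a * dot (p.1 - c0) (p.1 - c0)) ->
  forall p, swept Phi t1 p -> front c0 xi c p <= l ->
    zero_initial u p <= barrier c0 xi c b a p.
Proof.
set q := front c0 xi c; set w := barrier c0 xi c b a.
move=> [_ cu ub dt dx dxx eqn] w0 ul wK p0 Zp0 qp0.
rewrite leNgt; apply/negP => u0.
set Z := swept Phi t1 `&` [set p | q p <= l].
have cq : continuous q by exact: continuous_front.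
have cw : continuous w by exact: continuous_barrier.
have [||p] := @compact_EVT_max _ _ (fun p => zero_initial u p - w p) Z _
    (@compact_swept_front c0 xi c l).
- by exists p0.
- move=> x; apply: cvgB.
    by apply: (continuous_subspaceW _ cu); exact: subIsetl.
  exact: (continuous_subspaceT cw).
rewrite inE => -[Zp /= qp] pmax.
have {pmax} pmax z : swept Phi t1 z -> q z <= l -> zero_initial u z - w z <= zero_initial u p - w p.
  by move=> Zz qz; apply: pmax; rewrite inE.
have up : 0 < zero_initial u p - w p.
  by apply: lt_le_trans (pmax _ Zp0 qp0); rewrite subr_gt0.
have wp := w0 _ Zp qp.
have [p20|p2N] := eqVneq p.2 0.
  by move: up wp; rewrite /zero_initial p20 eqxx; lra.
have [/andP[p2ge p2t] Phip] := Zp.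
have p2 : 0 < p.2 by rewrite lt_neqAle eq_sym p2N.
have upE : zero_initial u p = u p by rewrite /zero_initial (negbTE p2N).
have Phip0 : 0 < Phi p.
  rewrite lt_neqAle Phip andbT eq_sym; apply/eqP => P0.
  by move: up; rewrite upE (ub _ Zp p2 P0); lra.
have Ip : swept_interior Phi t1 p by split => //; rewrite p2.
have ql : q p < l.
  rewrite lt_neqAle qp andbT; apply/eqP => qpl.
  by have := ul _ Ip qpl; rewrite -/w; move: up; rewrite upE; lra.
have nearp : \forall z \near p, [/\ 0 < Phi z, q z < l & 0 < z.2].
  have c2 : continuous (fun p : 'rV[R]_N * R => p.2) by move=> z; exact: cvg_snd.
  have N1 := near_superlevel cPhi Phip0.
  have N2 : \forall z \near p, q z < l by exact: (cq p _ (lt_nbhsl ql)).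
  have N3 := near_superlevel c2 p2.
  near=> z; split; near: z; [exact: N1|exact: N2|exact: N3].
have space (P : 'rV[R]_N * R -> Prop) : (\forall z \near p, P z) ->
    \forall y \near p.1, P (y, p.2).
  by rewrite {1}[p]surjective_pairing => /(@continuous_slice_space _ _ p.1 p.2).
have time (P : 'rV[R]_N * R -> Prop) : (\forall z \near p, P z) ->
    \forall s \near p.2, P (p.1, s).
  by rewrite {1}[p]surjective_pairing => /(@continuous_slice_time _ _ p.1 p.2).
apply: (@no_interior_max _ _ c0 xi c b a u K p).
- exact: dt.
- have ns : \forall y \near p.1, [/\ 0 < Phi (y, p.2), q (y, p.2) < l & 0 < p.2].
    exact: space nearp.
  apply: (@filterS _ _ (nbhs_filter p.1) _ _ _ ns) => y [Py _ _] i.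
  by apply: (@dx (y, p.2)); split => //=; rewrite p2.
- exact: dxx.
- exact: eqn.
- exact: wK.
- have nt : \forall s \near p.2^'-, [/\ 0 < Phi (p.1, s), q (p.1, s) < l & 0 < s].
    exact: (@cvg_within _ (nbhs p.2)  _ _ _ (time _ nearp)).
  near=> s.
  have [Ps qs s0] : [/\ 0 < Phi (p.1, s), q (p.1, s) < l & 0 < s] by near: s.
  have := pmax (p.1, s); rewrite upE /zero_initial/= (gt_eqF s0); apply; last exact: ltW.
  split => /=; last exact: ltW.
  by rewrite (ltW s0)/=; apply: le_trans p2t; near: s; exact: nbhs_left_le.
- have ns : \forall y \near p.1, [/\ 0 < Phi (y, p.2), q (y, p.2) < l & 0 < p.2].
    exact: space nearp.
  apply: (@filterS _ _ (nbhs_filter p.1) _ _ _ ns) => y [Py qy _].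
  have := pmax (y, p.2); rewrite upE /zero_initial/= (negbTE p2N); apply; last exact: ltW.
  by split => /=; [rewrite p2ge|exact: ltW].
Unshelve. all: by end_near. Qed.

End Swept.

(** * Linear growth and the receding front *)

Section Core.
Context {R : realType} {N : nat}.
Implicit Types (Phi u : 'rV[R]_N * R -> R) (p z : 'rV[R]_N * R).

Lemma sub_swept Phi (t t1 : R) : t <= t1 -> swept Phi t `<=` swept Phi t1.
Proof.
by move=> tt1 p [/andP[p0 pt] Pp]; split => //; rewrite p0 (le_trans pt).
Qed.

Lemma sub_swept_interior Phi (t t1 : R) : t <= t1 ->
  swept_interior Phi t `<=` swept_interior Phi t1.
Proof.
by move=> tt1 p [/andP[p0 pt] Pp]; split => //; rewrite p0 (le_trans pt).
Qed.

Lemma moving_subsolutionW Phi (t t1 K : R) u : t <= t1 ->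
  moving_subsolution Phi t1 K u -> moving_subsolution Phi t K u.
Proof.
move=> tt1 [cP cu ub dt dx dxx eqn].
have S := @sub_swept Phi _ _ tt1; have I := @sub_swept_interior Phi _ _ tt1.
split => //.
- exact: (continuous_subspaceW S cu).
- by move=> p /S; exact: ub.
- by move=> p /I; exact: dt.
- by move=> p /I; exact: dx.
- by move=> p /I; exact: dxx.
- by move=> p /I; exact: eqn.
Qed.

Lemma swept_interior_swept Phi (t1 : R) : swept_interior Phi t1 `<=` swept Phi t1.
Proof. by move=> p [/andP[p0 pt] Pp]; split; [rewrite (ltW p0)|exact: ltW]. Qed.

(** Comparison with lam |x|^2 + (K + (2 N + 1) lam) t, then lam tends to 0.  The
    quadratic term dominates the bounded function u far away; it costs 2 N lam
    in the equation, and one more lam makes the inequality strict. *)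
Lemma linear_growth Phi (t1 K M : R) u : 0 <= K -> 0 <= M ->
  moving_subsolution Phi t1 K u ->
  (forall p, swept Phi t1 p -> 0 < p.2 -> u p <= M) ->
  forall p, swept Phi t1 p -> zero_initial u p <= K * p.2.
Proof.
move=> K0 M0 sol uM p Sp; apply/ler_addgt0Pr => e e0.
have [/andP[p0 pt1] _] := Sp.
pose A := 1 + dot p.1 p.1 + (2 * N%:R + 1) * p.2.
have A0 : 0 < A.
  by rewrite /A -addrA ltr_pwDl// addr_ge0 ?dot_ge0// mulr_ge0// addr_ge0// mulr_ge0.
pose lam := e / A; have lam0 : 0 < lam by rewrite divr_gt0.
pose c := - (K / lam + (2 * N%:R + 1)).
have lamK : K / lam * lam = K by rewrite divfK// gt_eqF.
have lamc : lam * c = - (K + (2 * N%:R + 1) * lam) by rewrite /c; move: lamK; lra.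
have dot0 z : dot (z.1 - 0) (z.1 - 0) = dot z.1 z.1 by rewrite subr0.
have barE z : barrier 0 0 c lam 0 z =
    lam * dot z.1 z.1 + (K + (2 * N%:R + 1) * lam) * z.2.
  rewrite /barrier /front dot0 mul0r subr0 subr0 mulrBr mulrA lamc; ring.
have lamA : lam * A = e by rewrite /lam divfK// gt_eqF.
have barp : barrier 0 0 c lam 0 p <= K * p.2 + e.
  by rewrite barE; move: lamA; rewrite /A; nra.
apply: le_trans barp.
have [ql|ql] := leP (front 0 0 c p) (M / lam); last first.
  have uM' : zero_initial u p <= M.
    rewrite /zero_initial; case: eqVneq => // pN.
    by apply: uM => //; rewrite lt_neqAle eq_sym pN.
  apply: le_trans uM' _; rewrite /barrier mul0r subr0 mulrC.
  by rewrite -ler_pdivrMr// ltW.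
apply: (comparison (ms_Phi sol) sol _ _ _ Sp ql).
- move=> z [/andP[z0 _] _] _; rewrite barE addr_ge0//.
    by rewrite mulr_ge0 ?dot_ge0// ltW.
  by rewrite mulr_ge0// addr_ge0// mulr_ge0 ?ltW// addr_ge0 // mulr_ge0.
- move=> z Iz qz; rewrite /barrier qz mul0r subr0 mulrCA divff ?gt_eqF// mulr1.
  by apply: uM; [exact: swept_interior_swept|case: Iz => /andP[]].
- move=> z Iz qz; rewrite !(mulr0, mul0r, subr0, addr0) mulrC mulrN mulrDr lamc.
  by lra.
Qed.

(** At every point of the free boundary u leaves the value 0 with slope at least
    alpha along some unit inward direction - nu. *)
Definition boundary_slope_ge Phi (t1 alpha : R) u := forall p,
  swept Phi t1 p -> 0 < p.2 -> Phi p = 0 ->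
  exists nu : 'rV[R]_N, [/\ dot nu nu = 1,
    \forall h \near (0 : R)^'+, 0 < Phi (p.1 - h *: nu, p.2) &
    forall beta, beta < alpha -> \forall h \near (0 : R)^'+,
      beta * h <= u (p.1 - h *: nu, p.2)].

(** First contact argument.  The condition 4 a K t1 <= b^2 says that the largest
    value b^2 / (4 a) of b q - a q^2 is at least the bound K t1 of u; the condition
    on 8 a xi makes the barrier a strict supersolution; 2 b rho bounds its
    gradient on the sphere q = 0, of radius at most rho. *)
Lemma no_invasion Phi (t1 K : R) u (c0 : 'rV[R]_N) (xi c b a rho alpha : R) :
  0 <= K -> 0 < c -> 0 < b -> 0 < a -> 0 < xi -> 0 < rho ->
  moving_subsolution Phi t1 K u ->
  (forall p, swept Phi t1 p -> zero_initial u p <= K * p.2) ->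
  4 * a * (K * t1) <= b ^+ 2 ->
  (c + 2 * N%:R) * b + K < 8 * a * xi ->
  xi + c * t1 <= rho ^+ 2 -> 2 * b * rho < alpha ->
  (forall x, 0 <= Phi (x, 0) -> xi < dot (x - c0) (x - c0)) ->
  boundary_slope_ge Phi t1 alpha u ->
  forall p, swept Phi t1 p -> 0 < front c0 xi c p.
Proof.
move=> K0 c_gt0 b0 a0 xi0 rho0 sol ug aK axi xirho brho init normal p0 Sp0.
rewrite ltNge; apply/negP => qp0.
set q := front c0 xi c.
have cPhi := ms_Phi sol.
have cq : continuous q by exact: continuous_front.
have c2 : continuous (fun p : 'rV[R]_N * R => p.2) by move=> z; exact: cvg_snd.
have [||p] := @compact_EVT_min _ _ (fun p : 'rV[R]_N * R => p.2) _ _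
    (@compact_swept_front _ _ Phi t1 cPhi c0 xi c 0).
- by exists p0.
- exact: continuous_subspaceT.
rewrite inE => -[Sp /= qp] pmin.
(* p is a point of first contact with the closed ball q <= 0 *)
have {}pmin z : swept Phi t1 z -> z.2 < p.2 -> 0 < q z.
  move=> Sz zp; rewrite ltNge; apply/negP => qz.
  by move: zp; rewrite ltNge pmin// inE.
have [/andP[p2ge p2t] Phip] := Sp.
have p2 : 0 < p.2.
  rewrite lt_neqAle p2ge andbT eq_sym; apply/eqP => p20.
  have pE : (p.1, 0) = p by rewrite -p20 -surjective_pairing.
  have := init p.1; rewrite pE => /(_ Phip).
  by move: qp; rewrite /front p20; lra.
(* the domain at the time of contact is still outside the open ball: a point
   of D(t) inside it would have been there a moment earlier *)
have qint x : 0 < Phi (x, p.2) -> 0 <= q (x, p.2).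
  move=> Px; rewrite leNgt; apply/negP => qx.
  have near1 : \forall s \near p.2, [/\ 0 < Phi (x, s), q (x, s) < 0 & 0 < s].
    apply: (@continuous_slice_time _ _ x p.2 (fun z => [/\ 0 < Phi z, q z < 0 & 0 < z.2])).
    have N1 := near_superlevel cPhi Px.
    have N2 : \forall z \near (x, p.2), q z < 0 by exact: (cq (x, p.2) _ (lt_nbhsl qx)).
    have N3 : \forall z \near (x, p.2), 0 < z.2 by apply: (near_superlevel c2).
    near=> z; split; near: z; [exact: N1|exact: N2|exact: N3].
  have near2 : \forall s \near p.2^'-, [/\ 0 < Phi (x, s), q (x, s) < 0 & 0 < s].
    exact: (@cvg_within _ (nbhs p.2) _ _ _ near1).
  have : \forall s \near p.2^'-, False.
    near=> s.
    have [Ps qs s0] : [/\ 0 < Phi (x, s), q (x, s) < 0 & 0 < s] by near: s.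
    have sp : s < p.2 by near: s; exact: nbhs_left_lt.
    have Sz : swept Phi t1 (x, s).
      by split => /=; [rewrite (ltW s0) (le_trans (ltW sp) p2t)|exact: ltW].
    by have := pmin _ Sz sp; rewrite ltNge (ltW qs).
  by move/filter_ex => [].
have line (x v : 'rV[R]_N) (P : 'rV[R]_N * R -> Prop) :
    (\forall z \near (x, p.2), P z) -> \forall h \near (0 : R)^'+, P (x + h *: v, p.2).
  move=> HP; apply: (@near_ray _ _ x v (fun y => P (y, p.2))).
  exact: (@continuous_slice_space _ _ x p.2 _ HP).
have qge x : 0 <= Phi (x, p.2) -> 0 <= q (x, p.2).
  rewrite le_eqVlt => /orP[/eqP Px|]; last exact: qint.
  rewrite leNgt; apply/negP => qx.
  have Sx : swept Phi t1 (x, p.2) by split => //=; [rewrite p2ge|rewrite -Px].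
  have [nu [_ nuPhi _]] := normal _ Sx p2 (esym Px).
  have nq : \forall h \near (0 : R)^'+, q (x + h *: (- nu), p.2) < 0.
    by apply: (line x (- nu) (fun z => q z < 0)); exact: (cq (x, p.2) _ (lt_nbhsl qx)).
  have : \forall h \near (0 : R)^'+, False.
    near=> h.
    have : 0 <= q (x - h *: nu, p.2) by apply: qint; near: h.
    by apply/negP; rewrite -ltNge -scalerN; near: h.
  by move/filter_ex => [].
have q0 : q p = 0.
  by apply/eqP; rewrite eq_le qp /=; have := qge p.1; rewrite -surjective_pairing; apply.
have [z zE] : exists z : 'rV[R]_N, z = p.1 - c0 by exists (p.1 - c0).
have zz : dot z z = xi + c * p.2 by move: q0; rewrite /q /front -zE; lra.
have zz0 : 0 < dot z z by rewrite zz addr_gt0// mulr_gt0.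
(* p is not interior to D(t), from where the centre c0 could be approached *)
have Phi0 : Phi p = 0.
  apply/eqP; rewrite eq_le Phip andbT leNgt; apply/negP => Pp.
  have nP : \forall h \near (0 : R)^'+, 0 < Phi (p.1 + h *: (- z), p.2).
    by apply: (line p.1 (- z) (fun z => 0 < Phi z)); rewrite -surjective_pairing; exact: near_superlevel.
  have : \forall h \near (0 : R)^'+, False.
    near=> h.
    have h0 : 0 < h by near: h; exact: nbhs_right_gt.
    have h1 : h < 1 by near: h; exact: nbhs_right_lt.
    have : 0 <= q (p.1 + h *: (- z), p.2) by apply: qint; near: h.
    have -> : q (p.1 + h *: (- z), p.2) = (h ^+ 2 - 2 * h) * dot z z.
      rewrite /q /front/= [p.1 + _ - _]addrAC -zE.
      by rewrite !(dotDl, dotDr, dotZl, dotZr, dotNl, dotNr) zz; ring.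
    have h2 : 0 < 2 - h by lra.
    by have := mulr_gt0 (mulr_gt0 h0 h2) zz0; lra.
  by move/filter_ex => [].
have sol' : moving_subsolution Phi p.2 K u by exact: moving_subsolutionW sol.
have subS := @sub_swept Phi _ _ p2t.
have qS w : swept Phi p.2 w -> 0 <= q w.
  move=> Sw; have [/andP[_ wp] Pw] := Sw.
  move: wp; rewrite le_eqVlt => /orP[/eqP wp|wp]; last by apply: ltW; apply: pmin => //; exact: subS.
  by rewrite [w]surjective_pairing wp; apply: qge; rewrite -wp -surjective_pairing.
(* q = l is where the barrier reaches its maximum *)
pose l := b / (2 * a).
have l0 : 0 < l by rewrite /l divr_gt0// mulr_gt0.
have la : 2 * a * l = b by rewrite /l mulrC divfK// gt_eqF// mulr_gt0.
have below w : swept Phi p.2 w -> q w <= l -> zero_initial u w <= barrier c0 xi c b a w.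
  apply: (comparison cPhi sol').
  - move=> {}w Sw ql; have qw := qS _ Sw; rewrite /barrier -/q; move: ql; rewrite -/q => ql.
    have : q w * (b - a * q w) >= 0 by apply: mulr_ge0 => //; nra.
    by lra.
  - move=> {}w Iw ql; have := ug _ (subS _ (swept_interior_swept Iw)).
    have [/andP[w0 wp] _] := Iw.
    rewrite /zero_initial (gt_eqF w0) => H; apply: le_trans H _.
    rewrite /barrier ql; apply: (@le_trans _ _ (K * t1)).
      by rewrite ler_wpM2l// (le_trans wp).
    have : 4 * a * (K * t1) <= 4 * a * (b * l - a * l ^+ 2).
      by apply: le_trans aK _; rewrite -la; lra.
    by rewrite ler_pM2l// mulr_gt0.
  - move=> {}w Iw ql; have qw := qS _ (swept_interior_swept Iw).
    have [/andP[w0 wp] _] := Iw.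
    have dw : dot (w.1 - c0) (w.1 - c0) = q w + xi + c * w.2 by rewrite /q /front; lra.
    rewrite dw -/q.
    have cw : 0 <= c * w.2 by rewrite mulr_ge0// ltW.
    have H1 : 0 <= (c + 2 * N%:R) * (2 * a * q w).
      by rewrite mulr_ge0// ?mulr_ge0// ?addr_ge0// ?mulr_ge0// ltW.
    have H2 : 8 * a * xi <= 8 * a * (q w + xi + c * w.2).
      by rewrite ler_pM2l ?mulr_gt0//; lra.
    by move: axi H1 H2; lra.
have [nu [nu1 nuPhi nuu]] := normal _ Sp p2 Phi0.
pose beta := (2 * b * rho + alpha) / 2.
have betaa : beta < alpha by rewrite /beta; move: brho; lra.
have betab : 2 * b * rho < beta by rewrite /beta; move: brho; lra.
(* Cauchy-Schwarz, from 0 <= |z + rho nu|^2 *)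
have nuz : - rho <= dot nu z.
  have := dot_ge0 (z + rho *: nu).
  rewrite !(dotDl, dotDr, dotZl, dotZr) nu1 (dotC z nu) zz => H.
  have cp : c * p.2 <= c * t1 by rewrite ler_pM2l.
  rewrite -(ler_pM2l rho0); move: H xirho cp; nra.
have nq : \forall h \near (0 : R)^'+, q (p.1 + h *: (- nu), p.2) < l.
  apply: (line p.1 (- nu) (fun z => q z < l)); rewrite -surjective_pairing.
  by apply: (cq p _ (lt_nbhsl _)); rewrite q0.
have nb := nuu _ betaa.
have : \forall h \near (0 : R)^'+, False.
  near=> h.
  have h0 : 0 < h by near: h; exact: nbhs_right_gt.
  have hs : h < (beta - 2 * b * rho) / b.
    by near: h; apply: nbhs_right_lt; rewrite divr_gt0// subr_gt0.
  have Ph : 0 < Phi (p.1 - h *: nu, p.2) by near: h.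
  have qh : q (p.1 - h *: nu, p.2) < l by rewrite -scalerN; near: h.
  have uh : beta * h <= u (p.1 - h *: nu, p.2) by near: h.
  have Sh : swept Phi p.2 (p.1 - h *: nu, p.2) by split => /=; [rewrite p2ge lexx|exact: ltW].
  have := below _ Sh (ltW qh); rewrite /zero_initial/= (gt_eqF p2) => uw.
  have qE : q (p.1 - h *: nu, p.2) = h ^+ 2 - 2 * h * dot nu z.
    rewrite /q /front/= [p.1 - _ - _]addrAC -zE.
    by rewrite !(dotDl, dotDr, dotZl, dotZr, dotNl, dotNr) nu1 (dotC z nu) zz; ring.
  have bq : barrier c0 xi c b a (p.1 - h *: nu, p.2) <= b * q (p.1 - h *: nu, p.2).
    by rewrite /barrier -/q gerBl mulr_ge0 ?sqr_ge0// ltW.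
  have qle : q (p.1 - h *: nu, p.2) <= h ^+ 2 + 2 * h * rho.
    have H1 : 0 <= dot nu z + rho by rewrite -lerBlDr sub0r.
    by rewrite qE; have := mulr_ge0 (ltW h0) H1; lra.
  have : beta * h <= b * (h ^+ 2 + 2 * h * rho).
    by apply: le_trans uh _; apply: le_trans uw _; apply: le_trans bq _; rewrite ler_pM2l.
  move: hs; rewrite ltr_pdivlMr// => hs H.
  have : h * beta <= h * (b * h + 2 * b * rho) by move: H; lra.
  by rewrite ler_pM2l//; lra.
by move/filter_ex => [].
Unshelve. all: by end_near. Qed.

(** A time-independent displacement v of the squared radius suits all short times
    t1: speed v / t1 and curvature a then grow like 1 / t1 together.  Smallness of
    v is used in K v b <= rho0 b^2 / 2, that of t1 takes care of the remaining
    terms. *)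
Lemma front_parameters (k K b rho0 : R) : 0 <= k -> 0 < K -> 0 < b -> 0 < rho0 ->
  exists v t0 : R, [/\ 0 < v, v <= rho0, 0 < t0 &
    forall t1, 0 < t1 -> t1 <= t0 -> exists2 a, 0 < a &
      4 * a * (K * t1) <= b ^+ 2 /\
      (v / t1 + k) * b + K < 8 * a * (rho0 - v / 2)].
Proof.
move=> k0 K0 b0 rho00.
pose v := Num.min rho0 (rho0 * b / (2 * K)).
have v0 : 0 < v by rewrite /v lt_min rho00/= divr_gt0 ?mulr_gt0.
have v_rho : v <= rho0 by rewrite /v ge_min lexx.
have v_K : 2 * K * v <= rho0 * b.
  have : v <= rho0 * b / (2 * K) by rewrite /v ge_min lexx orbT.
  by rewrite ler_pdivlMr ?mulr_gt0// mulrC.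
pose L := 2 * K * (k * b + K + 1).
have L0 : 0 < L.
  have kb : 0 <= k * b by rewrite mulr_ge0// ltW.
  by rewrite /L !mulr_gt0//; lra.
exists v, (rho0 * b ^+ 2 / L); split => //.
  by rewrite divr_gt0// mulr_gt0// exprn_gt0.
move=> t1 t10; rewrite ler_pdivlMr// mulrC => t1L.
set c := v / t1; have c0 : 0 < c by rewrite divr_gt0.
have ct1 : c * t1 = v by rewrite /c divfK// gt_eqF.
have ckb : 0 < (c + k) * b by rewrite mulr_gt0// ltr_wpDr.
pose a := ((c + k) * b + K + 1) / (4 * rho0).
have a0 : 0 < a by rewrite /a divr_gt0// ?mulr_gt0//; lra.
have arho : 4 * a * rho0 = (c + k) * b + K + 1.
  by rewrite mulrAC mulrC /a divfK// gt_eqF// mulr_gt0.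
exists a => //; split.
  rewrite -(ler_pM2l rho00).
  have -> : rho0 * (4 * a * (K * t1)) = 4 * a * rho0 * (K * t1) by ring.
  have -> : 4 * a * rho0 * (K * t1) = K * (b * v + (k * b + K + 1) * t1).
    by rewrite arho -ct1; ring.
  have : b * (2 * K * v) <= b * (rho0 * b) by rewrite ler_pM2l.
  by move: t1L; rewrite /L; lra.
apply: (@lt_le_trans _ _ (4 * a * rho0)); first by rewrite arho; lra.
have : rho0 / 2 <= rho0 - v / 2 by lra.
by move/(ler_wpM2l (ltW a0)); lra.
Qed.

(** The sphere around c0 starts just inside the squared distance rho0 of c0 to
    the initial domain and ends at time t1 just beyond it; x1 is an initial point
    within the final ball that has not left D(t) by the time t1. *)
Lemma no_thin_start Phi (tau K M alpha : R) u (c0 x0 : 'rV[R]_N) (d : R) :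
  0 < tau -> 0 < K -> 0 <= M -> 0 < alpha -> 0 < d ->
  moving_subsolution Phi tau K u ->
  (forall p, swept Phi tau p -> 0 < p.2 -> u p <= M) ->
  boundary_slope_ge Phi tau alpha u ->
  (forall x, 0 <= Phi (x, 0) -> d <= dot (x - c0) (x - c0)) ->
  0 <= Phi (x0, 0) ->
  (forall x, 0 <= Phi (x, 0) -> closure [set z | 0 < Phi (z, 0)] x) ->
  False.
Proof.
move=> tau0 K0 M0 alpha0 d0 sol uM slope hd Px0 dense.
have cPhi := ms_Phi sol.
have growth := linear_growth (ltW K0) M0 sol uM.
pose A := [set r | exists2 x, 0 < Phi (x, 0) & r = dot (x - c0) (x - c0)].
have approx x : 0 <= Phi (x, 0) -> forall e, 0 < e -> exists2 z, 0 < Phi (z, 0) &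
    dot (z - c0) (z - c0) < dot (x - c0) (x - c0) + e.
  move=> /dense clx e e0.
  have cs : continuous (fun z : 'rV[R]_N => z - c0).
    move=> z; apply: (@cvgB _ _ _ _ (nbhs_filter z)); first exact: cvg_id.
    exact: (@cvg_cst _ _ _ _ (nbhs_filter z)).
  have xe : dot (x - c0) (x - c0) < dot (x - c0) (x - c0) + e by rewrite ltrDl.
  by have [z [Dz /= ze]] := clx _ (continuous_dot cs cs (lt_nbhsl xe)); exists z.
have A0 : A !=set0.
  have [z Dz _] := approx _ Px0 1 ltr01.
  by exists (dot (z - c0) (z - c0)); exists z.
have iA : has_inf A by split => //; exists d => r [x /ltW Dx ->]; exact: hd.
pose rho0 := inf A.
have rho0_gt0 : 0 < rho0.
  apply: lt_le_trans d0 _; apply: lb_le_inf => // r [x /ltW Dx ->]; exact: hd.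
have rho0_le x : 0 <= Phi (x, 0) -> rho0 <= dot (x - c0) (x - c0).
  move=> Px; apply/ler_addgt0Pr => e e0.
  have [z Dz /ltW ze] := approx _ Px e e0; apply: le_trans ze.
  by apply: ge_inf; [exact: iA.2|exists z].
have [rho rho_gt0 rho_big] : exists2 rho : R, 0 < rho & 2 * rho0 <= rho ^+ 2.
  exists (rho0 + 1); first by rewrite ltr_wpDl// ltW.
  by have := sqr_ge0 rho0; lra.
have [b b0 brho] : exists2 b : R, 0 < b & 2 * b * rho < alpha.
  exists (alpha / (4 * rho)); first by rewrite divr_gt0// mulr_gt0.
  have -> : 2 * (alpha / (4 * rho)) * rho = alpha / 2 by field; rewrite gt_eqF.
  by rewrite ltr_pdivrMr// ltr_pMr// ltr1n.
have N0 : 0 <= 2 * N%:R :> R by rewrite mulr_ge0.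
have [v [t0 [v0 v_rho t00 par]]] := front_parameters N0 K0 b0 rho0_gt0.
have [x1 Dx1 x1v] : exists2 x, 0 < Phi (x, 0) &
    dot (x - c0) (x - c0) < rho0 + v / 2.
  have v20 : 0 < v / 2 by rewrite divr_gt0.
  by have [_ [x Dx ->] xv] := inf_adherent v20 iA; exists x.
have Px1 : \forall t \near (0 : R)^'+, 0 < Phi (x1, t).
  apply: (@cvg_within _ (nbhs (0 : R))).
  exact: (@continuous_slice_time _ _ x1 0 _ (near_superlevel cPhi Dx1)).
have [t1 [t10 t1tau t1t0 Pt1]] : exists t1,
    [/\ 0 < t1, t1 <= tau, t1 <= t0 & 0 < Phi (x1, t1)].
  have : \forall t \near (0 : R)^'+,
      [/\ 0 < t, t <= tau, t <= t0 & 0 < Phi (x1, t)].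
    near=> t; split; [near: t; exact: nbhs_right_gt|near: t; exact: nbhs_right_le|
      near: t; exact: nbhs_right_le|by near: t].
  by move/filter_ex => [t]; exists t.
have [a a0 [aK axi]] := par _ t10 t1t0.
have ct1 : v / t1 * t1 = v by rewrite divfK// gt_eqF.
have sub p : swept Phi t1 p -> swept Phi tau p by exact: sub_swept.
have xi0 : 0 < rho0 - v / 2 by lra.
have S1 : swept Phi t1 (x1, t1) by split => /=; [rewrite lexx ltW|exact: ltW].
have : 0 < front c0 (rho0 - v / 2) (v / t1) (x1, t1).
  apply: (no_invasion (alpha := alpha) (ltW K0) (divr_gt0 v0 t10) b0 a0 xi0 rho_gt0
    (moving_subsolutionW t1tau sol)) S1 => //.
  - by move=> p /sub; exact: growth.
  - by rewrite ct1; apply: le_trans rho_big; lra.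
  - by move=> x /rho0_le xr; lra.
  - by move=> p /sub; exact: slope.
by rewrite /front /= ct1; lra.
Unshelve. all: by end_near. Qed.

End Core.

(** * Sheets extended to the initial time *)

Lemma uniform_cvg_dist (R : realType) (V : choiceType) (F : set_system R)
    (f : R -> V -> R) (g : V -> R) (e : R) :
  {uniform, f t @[t --> F] --> g} -> 0 < e ->
  \forall t \near F, forall y, `|g y - f t y| < e.
Proof.
move=> H e0; apply: (H [set h | forall y, `|g y - h y| < e]).
apply/uniform_nbhs; exists [set xy | ball xy.1 e xy.2]; split.
  exact: (entourage_ball _ (PosNum e0)).
by move=> h Hh y; have := Hh y I; rewrite /= -ball_normE.
Qed.

Section Sheet.
Context {R : realType} {n : nat}.

(** The sheet continued by its initial value for t <= 0 and frozen after the time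
    tau < T, so as to be continuous on the whole space-time. *)
Definition extend_sheet (s0 : 'rV[R]_n -> R) (s : 'rV[R]_n * R -> R) (tau : R)
    (p : 'rV[R]_n * R) : R :=
  if p.2 <= 0 then s0 p.1 else s (p.1, Num.min p.2 tau).

Lemma near_spacetime (a b : R) (p : 'rV[R]_n * R) :
  spacetime a b p -> \forall z \near p, spacetime a b z.
Proof.
move=> /andP[ap pb].
have c2 : continuous (fun p : 'rV[R]_n * R => p.2) by move=> z; exact: cvg_snd.
have N1 := near_superlevel c2 ap.
have N2 : \forall z \near p, z.2 < b by exact: (c2 p _ (lt_nbhsl pb)).
by apply: filterS (filterI N1 N2) => z [? ?]; apply/andP.
Qed.

Lemma continuous_extend_sheet (T tau : R) (s0 : 'rV[R]_n -> R)
    (s : 'rV[R]_n * R -> R) :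
  0 < tau < T -> continuous s0 -> {within spacetime 0 T, continuous s} ->
  {uniform, at_time s t @[t --> (0 : R)^'+] --> s0} ->
  continuous (extend_sheet s0 s tau).
Proof.
move=> /andP[tau0 tauT] cs0 cs us0 [y t].
have c1 : continuous (fun p : 'rV[R]_n * R => s0 p.1).
  by move=> z; apply: continuous_comp; [exact: cvg_fst|exact: cs0].
have c2 : continuous (fun p : 'rV[R]_n * R => p.2) by move=> z; exact: cvg_snd.
apply/cvgrPdist_lt => e e0.
have [t0|t0|t0] := ltgtP t 0.
- have N2 : \forall z \near (y, t), z.2 < 0 by exact: (c2 (y, t) _ (lt_nbhsl t0)).
  have /cvgrPdist_lt /(_ e e0) N1 := c1 (y, t).
  apply: filterS (filterI N1 N2) => z [+ z0].
  by rewrite /extend_sheet (ltW z0)/= (ltW t0).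
- have N2 : \forall z \near (y, t), 0 < z.2 by apply: near_superlevel.
  have cm : {for (y, t), continuous (fun p : 'rV[R]_n * R => s (p.1, Num.min p.2 tau))}.
    apply: (@continuous_comp _ _ _ (fun p : 'rV[R]_n * R => (p.1, Num.min p.2 tau)) s).
      apply: (@cvg_pair _ _ _ _ _ _ (nbhs_filter _) (nbhs_filter _) (nbhs_filter _)); first exact: cvg_fst.
      by apply: continuous_min; [exact: cvg_snd|exact: cvg_cst].
    apply: (within_continuous_at cs); apply: near_spacetime.
    by rewrite /spacetime/= lt_min t0 tau0/= gt_min tauT orbT.
  have /cvgrPdist_lt /(_ e e0) N1 := cm.
  apply: filterS (filterI N1 N2) => z [+ z0].
  by rewrite /extend_sheet !leNgt z0 /= t0.
- subst t; have e20 : 0 < e / 2 by rewrite divr_gt0.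
  have /cvgrPdist_lt /(_ _ e20) N1 := c1 (y, 0).
  have [d /= d0 hd] := uniform_cvg_dist us0 e20.
  have N2 : \forall z \near (y, 0 : R), z.2 < d by exact: (c2 (y, 0) _ (lt_nbhsl d0)).
  have N3 : \forall z \near (y, 0 : R), z.2 < tau by exact: (c2 (y, 0) _ (lt_nbhsl tau0)).
  apply: filterS (filterI N1 (filterI N2 N3)) => z [/= sz [zd ztau]].
  rewrite /extend_sheet /= lexx; case: ifPn => [_|].
    by apply: lt_trans sz _; rewrite ltr_pdivrMr// ltr_pMr// ltr1n.
  rewrite -ltNge => z0; rewrite (min_idPl (ltW ztau)).
  have := hd z.2; rewrite /= sub0r normrN gtr0_norm// => /(_ zd z0 z.1).
  rewrite /at_time/= => sz'.
  have -> : s0 y - s (z.1, z.2) = (s0 y - s0 z.1) + (s0 z.1 - s (z.1, z.2)).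
    by rewrite addrA subrK.
  by rewrite [e]splitr (le_lt_trans (ler_normD _ _))// ltrD.
Qed.

End Sheet.

(** * Domains between two graphs *)

Section Geometry.
Context {R : realType} {N : nat}.
Variables (m : 'rV[R]_N) (E : 'M[R]_(N.-1, N)).
Hypotheses (hm : dot m m = 1) (hE : hyperplane_frame m E).

Lemma dot_mulmxE (k : nat) (x y : 'rV[R]_k) : dot x y = (x *m y^T) 0 0.
Proof. by rewrite mxE; apply: eq_bigr => i _; rewrite mxE. Qed.

Lemma dot_adjoint (k l : nat) (A : 'M[R]_(k, l)) (v : 'rV[R]_k) (x : 'rV[R]_l) :
  dot (v *m A) x = dot v (x *m A^T).
Proof. by rewrite !dot_mulmxE trmx_mul trmxK mulmxA. Qed.

Lemma mulmx_frame0 : m *m E^T = 0.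
Proof. by have [_ Em] := hE; rewrite -[m]trmxK -trmx_mul Em trmx0. Qed.

Lemma tcoordE x : tcoord m E x = x *m E^T.
Proof.
by rewrite /tcoord /orthoproj mulmxBl -scalemxAl mulmx_frame0 scaler0 subr0.
Qed.

Lemma tcoordD x y : tcoord m E (x + y) = tcoord m E x + tcoord m E y.
Proof. by rewrite !tcoordE mulmxDl. Qed.

Lemma tcoordZ a x : tcoord m E (a *: x) = a *: tcoord m E x.
Proof. by rewrite !tcoordE -scalemxAl. Qed.

Lemma tcoord_axis : tcoord m E m = 0.
Proof. by rewrite tcoordE mulmx_frame0. Qed.

Lemma tcoord_tangent v : tcoord m E (v *m E) = v.
Proof. by have [EE _] := hE; rewrite tcoordE -mulmxA EE mulmx1. Qed.

Lemma dot_tangent_axis v : dot (v *m E) m = 0.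
Proof.
rewrite dot_adjoint mulmx_frame0 /dot big1// => i _.
by rewrite mxE mulr0.
Qed.

Lemma dot_tangent v w : dot (v *m E) (w *m E) = dot v w.
Proof. by have [EE _] := hE; rewrite dot_adjoint -mulmxA EE mulmx1. Qed.

Lemma continuous_tcoord : continuous (tcoord m E).
Proof.
apply: continuous_rV => i.
have -> : (fun p => tcoord m E p 0 i) = (fun p => dot p (row i E)).
  apply/funext => p; rewrite tcoordE /dot mxE.
  by apply: eq_bigr => j _; rewrite !mxE.
by apply: continuous_dot; [move=> p; exact: cvg_id|exact: cst_continuous].
Qed.

Lemma unit_normal (v : 'rV[R]_(N.-1)) :
  let nu := (Num.sqrt (1 + dot v v))^-1 *: (m - v *m E) in dot nu nu = 1.
Proof.
have v0 : 0 < 1 + dot v v by rewrite ltr_pwDl// dot_ge0.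
rewrite /= dotZl dotZr !(dotDl, dotDr, dotNl, dotNr) hm dot_tangent_axis.
rewrite (dotC m) dot_tangent_axis dot_tangent oppr0 addr0 add0r opprK.
rewrite mulrA -expr2 exprVn sqr_sqrtr ?ltW// mulVf// gt_eqF//.
Qed.

Section Thickness.
Variables (gm gp : 'rV[R]_(N.-1) * R -> R).

Definition thickness (p : 'rV[R]_N * R) : R :=
  Num.min (gp (tcoord m E p.1, p.2) - dot p.1 m)
          (dot p.1 m - gm (tcoord m E p.1, p.2)).

Lemma continuous_thickness :
  continuous gm -> continuous gp -> continuous thickness.
Proof.
move=> cgm cgp.
have ct : continuous (fun p : 'rV[R]_N * R => (tcoord m E p.1, p.2)).
  move=> p; apply: (@cvg_pair _ _ _ _ _ _ (nbhs_filter _) (nbhs_filter _) (nbhs_filter _)); last exact: cvg_snd.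
  by apply: continuous_comp; [exact: cvg_fst|exact: continuous_tcoord].
have cd : continuous (fun p : 'rV[R]_N * R => dot p.1 m).
  by apply: continuous_dot; [move=> p; exact: cvg_fst|exact: cst_continuous].
move=> p; apply: (@continuous_min _ _
  (fun p => gp (tcoord m E p.1, p.2) - dot p.1 m)
  (fun p => dot p.1 m - gm (tcoord m E p.1, p.2))).
  apply: cvgB; last exact: cd.
  by apply: (continuous_comp (ct p)); exact: cgp.
apply: cvgB; first exact: cd.
by apply: (continuous_comp (ct p)); exact: cgm.
Qed.

Lemma thickness_gt0 p : (0 < thickness p) =
  (gm (tcoord m E p.1, p.2) < dot p.1 m < gp (tcoord m E p.1, p.2)).
Proof. by rewrite /thickness lt_min !subr_gt0 andbC. Qed.

Lemma thickness_ge0 p : (0 <= thickness p) =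
  (gm (tcoord m E p.1, p.2) <= dot p.1 m <= gp (tcoord m E p.1, p.2)).
Proof. by rewrite /thickness le_min !subr_ge0 andbC. Qed.

Lemma thickness_eq0 p : thickness p = 0 ->
  dot p.1 m = gp (tcoord m E p.1, p.2) \/ dot p.1 m = gm (tcoord m E p.1, p.2).
Proof. by rewrite /thickness; case: ltP => _ /eqP; rewrite subr_eq0 => /eqP; auto. Qed.

End Thickness.

(** Points between the closed graphs are pushed along the axis m towards the
    midpoint of the two sheets. *)
Lemma closure_graph_domain (sm sp : 'rV[R]_(N.-1) -> R) x :
  sm (tcoord m E x) < sp (tcoord m E x) ->
  sm (tcoord m E x) <= dot x m <= sp (tcoord m E x) ->
  closure (graph_domain m E sm sp) x.
Proof.
move=> smp /andP[smx xsp] B Bx.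
set y := tcoord m E x in smp smx xsp *.
pose d := (sm y + sp y) / 2 - dot x m.
have nB : \forall h \near (0 : R)^'+, B (x + h *: (d *: m)) by exact: near_ray.
have : \forall h \near (0 : R)^'+, (graph_domain m E sm sp `&` B) (x + h *: (d *: m)).
  near=> h; split; last by near: h.
  have h0 : 0 < h by near: h; exact: nbhs_right_gt.
  have h1 : h < 1 by near: h; exact: nbhs_right_lt.
  rewrite /graph_domain/= tcoordD !tcoordZ tcoord_axis !scaler0 addr0 -/y.
  rewrite dotDl !dotZl hm mulr1 /d.
  by apply/andP; split; nra.
by move/filter_ex => [h H]; exists (x + h *: (d *: m)).
Unshelve. all: by end_near. Qed.

End Geometry.

(** * The solution near the free boundary *)

Section C21.
Context {R : realType} {n : nat}.
Implicit Types (A : set ('rV[R]_n * R)) (h : 'rV[R]_n * R -> R).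

Lemma within_continuous_slice (U : topologicalType) A (f : 'rV[R]_n * R -> U) x t :
  {within A, continuous f} -> (\forall y \near x, A (y, t)) ->
  {for x, continuous (fun y => f (y, t))}.
Proof.
move=> /subspace_continuousP cf nA W /= fW.
have Wf : \forall z \near (x, t), A z -> W (f z) := cf _ (nbhs_singleton nA) W fW.
have Wf' := @continuous_slice_space _ _ x t _ Wf.
by apply: (@filterS _ _ (nbhs_filter x) _ _ _ (@filterI _ _ (nbhs_filter x) _ _ nA Wf')) => y [Ay]; exact.
Qed.

Lemma C21_directional A h x t v : C21_on A h -> (\forall y \near x, A (y, t)) ->
  is_derive x v (at_time h t) (dot v (grad h (x, t))).
Proof.
move=> [dh _ _ cdh _] nA.
have -> : dot v (grad h (x, t)) = \sum_i v 0 i * pd i (at_time h t) x.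
  by apply: eq_bigr => i _; rewrite mxE.
apply: is_derive_partials.
  by apply: (@filterS _ _ (nbhs_filter x) _ _ _ nA) => y /dh[].
by move=> i; apply: (within_continuous_slice (cdh i) nA).
Qed.

End C21.

Section BoundarySlope.
Context {R : realType} {N : nat}.

(** Along the inward normal ray the derivative of u is - dot nu grad u, which tends
    to alpha; the mean value theorem on [0, h] only needs u to be continuous at
    the boundary end point. *)
Lemma boundary_slope (Q S : set ('rV[R]_N * R)) (u : 'rV[R]_N * R -> R)
    (G : 'rV[R]_N * R -> 'rV[R]_N) (alpha : R) (x nu : 'rV[R]_N) (t : R) :
  C21_on Q u -> {within Q `|` S, continuous u} ->
  {within Q `|` S, continuous G} -> (forall p, Q p -> G p = grad u p) ->
  (forall y, Q (y, t) -> \forall z \near y, Q (z, t)) ->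
  S (x, t) -> u (x, t) = 0 -> dot (G (x, t)) nu = - alpha ->
  (\forall h \near (0 : R)^'+, Q (x - h *: nu, t)) ->
  forall beta, beta < alpha ->
    \forall h \near (0 : R)^'+, beta * h <= u (x - h *: nu, t).
Proof.
move=> Qu cu cG GE Qopen Sx ux Gnu nQ beta betaa.
pose ph (h : R) := (x + h *: (- nu), t).
have phE h : ph h = (x - h *: nu, t) by rewrite /ph scalerN.
have nQph : \forall h \near (0 : R)^'+, Q (ph h).
  by apply: filterS nQ => h; rewrite phE.
have QSx : (Q `|` S) (x, t) by right.
have toedge (U : topologicalType) (F : 'rV[R]_N * R -> U) :
    {within Q `|` S, continuous F} -> (F \o ph) @ (0 : R)^'+ --> F (x, t).
  move=> /subspace_continuousP cF W FW.
  have WF : \forall z \near (x, t), (Q `|` S) z -> W (F z) := cF _ QSx W FW.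
  have H' : \forall h \near (0 : R)^'+, (Q `|` S) (ph h) -> W (F (ph h)).
    apply: (@near_ray _ _ x (- nu) (fun y => (Q `|` S) (y, t) -> W (F (y, t)))).
    exact: (@continuous_slice_space _ _ x t _ WF).
  by apply: filterS (filterI nQph H') => h [Qh]; apply; left.
have slope : \forall h \near (0 : R)^'+, beta < dot (- nu) (G (ph h)).
  have cd : continuous (fun g : 'rV[R]_N => dot (- nu) g).
    by apply: continuous_dot; [exact: cst_continuous|move=> g; exact: cvg_id].
  have bG : beta < dot (- nu) (G (x, t)) by rewrite dotNl dotC Gnu opprK.
  exact: (toedge _ G cG _ (near_superlevel cd bG)).
have [d /= d0 hd] := filterI nQph slope.
have {}hd s : 0 < s -> s < d -> Q (ph s) /\ beta < dot (- nu) (grad u (ph s)).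
  move=> s0 sd; have [] := hd s; rewrite /= ?sub0r ?normrN ?gtr0_norm//.
  by move=> Qs; rewrite GE.
have D s : 0 < s -> s < d ->
    is_derive s (1 : R) (fun s => u (ph s)) (dot (- nu) (grad u (ph s))).
  move=> s0 sd; apply: (@is_derive_line _ _ (at_time u t)).
  apply: (C21_directional _ Qu); apply: Qopen.
  by have [] := hd s s0 sd.
exists d => // h /=; rewrite sub0r normrN => hd' h0.
rewrite gtr0_norm// in hd'.
have [||s] := @MVT _ (fun s => u (ph s)) (fun s => dot (- nu) (grad u (ph s))) 0 h h0.
- move=> s; rewrite in_itv/= => /andP[s0 sh]; apply: D => //; exact: lt_trans hd'.
- apply/continuous_within_itvP => //; split.
  + move=> s; rewrite in_itv/= => /andP[s0 sh].
    have Ds := D s s0 (lt_trans sh hd').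
    have := @ex_derive _ _ _ _ _ _ _ Ds.
    by move/derivable1_diffP/differentiable_continuous.
  + by rewrite /ph scale0r addr0; exact: (toedge _ u cu).
  + have Ds := D h h0 hd'.
    have := @ex_derive _ _ _ _ _ _ _ Ds.
    move/derivable1_diffP/differentiable_continuous => C.
    exact: cvg_at_left_filter C.
rewrite in_itv/= => /andP[s0 sh].
have -> : u (ph 0) = 0 by rewrite /ph scale0r addr0.
rewrite !subr0 -phE => ->.
have [_ bs] := hd s s0 (lt_trans sh hd').
by rewrite ler_pM2r// ltW.
Qed.

End BoundarySlope.

Section InwardNormal.
Context {R : realType} {N : nat}.
Variables (m : 'rV[R]_N) (E : 'M[R]_(N.-1, N)).
Hypotheses (hm : dot m m = 1) (hE : hyperplane_frame m E).
Variables (T : R) (sm sp gm gp : 'rV[R]_(N.-1) * R -> R) (x : 'rV[R]_N) (t : R).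
Hypotheses (Csm : C21_on (spacetime 0 T) sm) (Csp : C21_on (spacetime 0 T) sp).
(* gm and gp stand for the sheets extended to all times *)
Hypotheses (cgm : continuous gm) (cgp : continuous gp).
Hypothesis t0T : 0 < t < T.
Hypotheses (gmE : forall y, gm (y, t) = sm (y, t))
           (gpE : forall y, gp (y, t) = sp (y, t)).
Hypothesis smp : forall y, sm (y, t) < sp (y, t).
Hypothesis edge : thickness m E gm gp (x, t) = 0.

Let nu := exterior_normal m E sm sp (x, t).
Let y := tcoord m E x.

Lemma exterior_normal_unit : dot nu nu = 1.
Proof.
rewrite /nu /exterior_normal; case: ifP => _; last rewrite dotNl dotNr opprK.
  exact: (unit_normal hm hE).
exact: (unit_normal hm hE).
Qed.

(** On the upper sheet, with gradient v and k = (1 + |v|^2)^(-1/2), the step from x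
    to x - h nu raises the sheet over the base point by h k |v|^2 at first order and
    lowers the height of x by h k, so the gap to this sheet opens at the rate
    sqrt (1 + |v|^2); the gap to the other sheet stays positive by continuity.  The
    lower sheet is symmetric. *)
Lemma exterior_normal_inward :
  \forall h \near (0 : R)^'+, 0 < thickness m E gm gp (x - h *: nu, t).
Proof.
have sheet s w : C21_on (spacetime 0 T) s ->
    is_derive (0 : R) (1 : R) (fun h => s (y + h *: w, t)) (dot w (grad s (y, t))).
  move=> Cs; apply: (@is_derive_line _ _ (at_time s t)).
  rewrite scale0r addr0; apply: (C21_directional _ Cs).
  by apply: (@filterE _ _ (nbhs_filter y)).
have line (g : 'rV[R]_(N.-1) * R -> R) (w : 'rV[R]_N) : continuous g ->
    continuous (fun h : R => g (tcoord m E (x + h *: w), t) - dot (x + h *: w) m).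
  move=> cg.
  have cl := @continuous_line R N x w.
  have cy : continuous (fun h : R => (tcoord m E (x + h *: w), t)).
    move=> h; apply: (@cvg_pair _ _ _ _ _ _ (nbhs_filter _) (nbhs_filter _) (nbhs_filter _)).
      by apply: (continuous_comp (cl h)); exact: continuous_tcoord.
    exact: cvg_cst.
  move=> h; apply: cvgB.
    by apply: (continuous_comp (cy h)); exact: cg.
  by apply: (@continuous_dot _ _ _ (fun h : R => x + h *: w) (fun=> m)); [exact: cl|exact: cst_continuous].
have kpos (v : 'rV[R]_(N.-1)) : 0 < (Num.sqrt (1 + dot v v))^-1.
  by rewrite invr_gt0 sqrtr_gt0 ltr_pwDl// dot_ge0.
have := thickness_eq0 edge; rewrite /= gpE gmE -/y => -[xp|xm].
- have nuE : nu = upward_normal m E sp (x, t) by rewrite /nu /exterior_normal /= xp eqxx.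
  rewrite nuE /upward_normal /= -/y.
  set v := grad sp (y, t); set k := (Num.sqrt _)^-1; have k0 : 0 < k := kpos v.
  have N1 : \forall h \near (0 : R)^'+, sp (y, t) < sp (y + h *: (k *: v), t) + h * k.
    have H : is_derive (0 : R) (1 : R) (fun h : R => sp (y + h *: (k *: v), t) + h * k)
        (k * dot v v + k).
      have D1 := sheet sp (k *: v) Csp.
      have D2 : is_derive (0 : R) (1 : R) (fun h : R => h * k) k.
        by apply: (@is_derive_horner _ (k *: 'X)) => [h|]; rewrite ?poly.derivE !hornerE// mulrC.
      by have := is_deriveD D1 D2; rewrite dotZl.
    have := right_increase H; rewrite scale0r addr0 mul0r addr0; apply.
    by rewrite ltr_wpDl// mulr_ge0 ?dot_ge0// ltW.
  have N2 : \forall h \near (0 : R)^'+,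
      gm (tcoord m E (x + h *: (- (k *: (m - v *m E)))), t) - dot (x + h *: (- (k *: (m - v *m E)))) m < 0.
    have c0 : gm (tcoord m E (x + 0 *: (- (k *: (m - v *m E)))), t) -
       dot (x + 0 *: (- (k *: (m - v *m E)))) m < 0.
      by rewrite scale0r addr0 gmE -/y xp subr_lt0.
    exact: (@cvg_within _ (nbhs (0 : R)) _ _ _ (line gm _ cgm _ _ (lt_nbhsl c0))).
  near=> h.
  have h1 : sp (y, t) < sp (y + h *: (k *: v), t) + h * k by near: h.
  rewrite thickness_gt0 /=; apply/andP; split.
    by rewrite -subr_lt0 -scalerN; near: h.
  rewrite gpE tcoordD// -scalerN tcoordZ// -scalerN tcoordZ// opprB tcoordD//.
  rewrite tcoord_tangent// -[- m]scaleN1r tcoordZ// (tcoord_axis hE) scaler0 addr0 -/y.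
  rewrite dotDl !dotZl dotDl (dot_tangent_axis hE) dotZl hm xp; lra.
- have nuE : nu = - upward_normal m E sm (x, t).
    by rewrite /nu /exterior_normal /= -/y xm lt_eqF.
  rewrite nuE /upward_normal /= -/y.
  set v := grad sm (y, t); set k := (Num.sqrt _)^-1; have k0 : 0 < k := kpos v.
  have N1 : \forall h \near (0 : R)^'+, - sm (y, t) < - sm (y + h *: (- (k *: v)), t) + h * k.
    have H : is_derive (0 : R) (1 : R) (fun h : R => - sm (y + h *: (- (k *: v)), t) + h * k)
        (k * dot v v + k).
      have D1 := is_deriveN (sheet sm (- (k *: v)) Csm).
      have D2 : is_derive (0 : R) (1 : R) (fun h : R => h * k) k.
        by apply: (@is_derive_horner _ (k *: 'X)) => [h|]; rewrite ?poly.derivE !hornerE// mulrC.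
      by have := is_deriveD D1 D2; rewrite dotNl opprK dotZl.
    have := right_increase H; rewrite scale0r addr0 mul0r addr0; apply.
    by rewrite ltr_wpDl// mulr_ge0 ?dot_ge0// ltW.
  have N2 : \forall h \near (0 : R)^'+,
      0 < gp (tcoord m E (x + h *: (k *: (m - v *m E))), t) - dot (x + h *: (k *: (m - v *m E))) m.
    have c0 : 0 < gp (tcoord m E (x + 0 *: (k *: (m - v *m E))), t) -
       dot (x + 0 *: (k *: (m - v *m E))) m.
      by rewrite scale0r addr0 gpE -/y xm subr_gt0.
    exact: (@cvg_within _ (nbhs (0 : R)) _ _ _ (line gp _ cgp _ _ (lt_nbhsr c0))).
  near=> h.
  have h1 : - sm (y, t) < - sm (y + h *: (- (k *: v)), t) + h * k by near: h.
  rewrite thickness_gt0 /= scalerN opprK; apply/andP; split; last first.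
    by rewrite -subr_gt0; near: h.
  rewrite gmE tcoordD// tcoordZ// tcoordZ// tcoordD//.
  rewrite -[- (v *m E)]mulNmx tcoord_tangent// (tcoord_axis hE) add0r scalerN -/y.
  rewrite dotDl !dotZl dotDl (dot_tangent_axis hE) hm xm; lra.
Unshelve. all: by end_near. Qed.

End InwardNormal.

(** * The initial domain and the contradiction *)

Section Assembly.
Context {R : realType} {N : nat}.
Variables (m : 'rV[R]_N) (E : 'M[R]_(N.-1, N)).
Hypotheses (hm : dot m m = 1) (hE : hyperplane_frame m E).

Lemma frontier_graph_domain (sm sp : 'rV[R]_(N.-1) -> R) x :
  sm (tcoord m E x) < sp (tcoord m E x) ->
  dot x m = sp (tcoord m E x) \/ dot x m = sm (tcoord m E x) ->
  frontier (graph_domain m E sm sp) x.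
Proof.
move=> smp edge; split.
  by apply: closure_graph_domain => //; case: edge => ->; rewrite lexx ltW.
move=> /interior_subset; rewrite /graph_domain/=.
by case: edge => ->; rewrite ltxx ?andbF.
Qed.

(** A point strictly above the upper graph has a positive distance to everything
    below it.  The topology is that of the sup norm, hence the square d^2 of a
    sup-norm radius as a lower bound for the Euclidean expression. *)
Lemma graph_domain_dist (sp : 'rV[R]_(N.-1) -> R) (c0 : 'rV[R]_N) :
  continuous sp -> sp (tcoord m E c0) < dot c0 m ->
  exists2 d : R, 0 < d & forall x, dot x m <= sp (tcoord m E x) ->
    d <= dot (x - c0) (x - c0).
Proof.
move=> csp c0up.
have cF : continuous (fun x => dot x m - sp (tcoord m E x)).
  have cd : continuous (fun x : 'rV[R]_N => dot x m).
    by apply: continuous_dot; [move=> z; exact: cvg_id|exact: cst_continuous].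
  have cs : continuous (fun x : 'rV[R]_N => sp (tcoord m E x)).
    by move=> z; apply: continuous_comp; [exact: continuous_tcoord|exact: csp].
  move=> x; apply: (@cvgB _ _ _ _ (nbhs_filter x)); first exact: cd.
  exact: cs.
have F0 : 0 < dot c0 m - sp (tcoord m E c0) by rewrite subr_gt0.
have /nbhs_ballP[d /= d0 hd] := near_superlevel cF F0.
exists (d ^+ 2); first exact: exprn_gt0.
move=> x xsp; rewrite leNgt; apply/negP => xc.
have /hd : ball c0 d x.
  rewrite -ball_normE /= -normrN opprB; apply: mxnorm_lt_coord => // j.
  rewrite -(@ltr_pXn2r _ 2)// ?nnegrE ?(ltW d0)// real_normK ?num_real//.
  exact: le_lt_trans (sqr_coord_le_dot _ _) xc.
by rewrite /= subr_gt0 ltNge xsp.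
Qed.

End Assembly.

Lemma admissible_extension (R : realType) (N : nat) (T : R)
    (s : 'rV[R]_N.-1 * R -> R) (s0 : 'rV[R]_N.-1 -> R) :
  0 < T -> C2 s0 -> admissible_sheet T s s0 ->
  continuous (extend_sheet s0 s (T / 2)).
Proof.
move=> T0 [_ _ cs0 _ _] [[_ cs _ _ _] _ [us _ _]].
by apply: (continuous_extend_sheet _ cs0 cs us); apply/andP; split; lra.
Qed.

Theorem corollary1p5 (R : realType) (N : nat) (hN : (2 <= N)%N)
  (alpha T : R) (halpha : 0 < alpha) (hT : 0 < T)
  (f : 'rV[R]_N * R -> R)
  (hf0 : forall p, spacetime 0 T p -> 0 <= f p)
  (hfb : exists M : R, forall p, spacetime 0 T p -> `|f p| <= M)
  (hfm : lebesgue_measurable_on (spacetime 0 T) f)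
  (m : 'rV[R]_N) (hm : dot m m = 1)
  (E : 'M[R]_(N.-1, N)) (hE : hyperplane_frame m E)
  (s0m s0p : 'rV[R]_(N.-1) -> R)
  (hs0m : C2 s0m /\ bounded_derivatives2 s0m)
  (hs0p : C2 s0p /\ bounded_derivatives2 s0p)
  (hs0 : forall y, s0m y < s0p y) :
  ~ exists (u : 'rV[R]_N * R -> R) (sm sp : 'rV[R]_(N.-1) * R -> R),
      ivp_solution m E T alpha f (fun=> 0) s0m s0p u sm sp.
Proof.
case=> u [sm] [sp] [[asm asp] smp [Qu cu _ eqn [uS [G [cG GE Gnu]]]] [M uM] cu0].
have [K0 fK0] := hfb.
pose K := `|K0| + 1; have Kpos : 0 < K by rewrite /K ltr_wpDl.
have fK p : spacetime 0 T p -> f p <= K.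
  move=> /fK0; rewrite /K => H; apply: le_trans (ler_norm _) _; apply: le_trans H _.
  by apply: le_trans (ler_norm _) _; rewrite lerDl.
(* the sheets are continuous up to any time before T *)
pose tau := T / 2; have tau0 : 0 < tau by rewrite /tau; lra.
have tauT : tau < T by rewrite /tau; lra.
pose gm := extend_sheet s0m sm tau; pose gp := extend_sheet s0p sp tau.
have cgm : continuous gm := admissible_extension hT hs0m.1 asm.
have cgp : continuous gp := admissible_extension hT hs0p.1 asp.
have extE s0 s y t : 0 < t <= tau -> @extend_sheet R N.-1 s0 s tau (y, t) = s (y, t).
  by move=> /andP[t0 tt]; rewrite /extend_sheet /= leNgt t0 /= (min_idPl tt).
have ext0 s0 s y : @extend_sheet R N.-1 s0 s tau (y, 0) = s0 y.
  by rewrite /extend_sheet /= lexx.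
pose Phi := thickness m E gm gp.
have cPhi : continuous Phi := continuous_thickness hE cgm cgp.
have inT t : 0 < t <= tau -> 0 < t < T.
  by move=> /andP[-> tt]; exact: le_lt_trans tauT.
have PhiQ x t : 0 < t <= tau -> 0 < Phi (x, t) -> QT m E T sm sp (x, t).
  move=> tt; rewrite thickness_gt0 /= /gm /gp !extE// => H.
  by split; [exact: inT|].
have PhiS x t : 0 < t <= tau -> Phi (x, t) = 0 -> ST m E T sm sp (x, t).
  move=> tt /thickness_eq0 /=; rewrite /gm /gp !extE// => H.
  split; first exact: inT.
  by apply: (frontier_graph_domain hm hE) => //; apply: smp; exact: inT.
have PhiQS x t : 0 < t <= tau -> 0 <= Phi (x, t) ->
    (QT m E T sm sp `|` ST m E T sm sp) (x, t).
  move=> tt; rewrite le_eqVlt => /orP[/eqP H|H].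
    by right; apply: PhiS.
  by left; apply: PhiQ.
have cl0 x : 0 <= Phi (x, 0) -> closure (graph_domain m E s0m s0p) x.
  rewrite thickness_ge0 /= /gm /gp !ext0 => H.
  exact: (closure_graph_domain hm hE).
have sol : moving_subsolution Phi tau K u.
  split => //.
  - apply: (@continuous_subspaceW _ _ _ (QT m E T sm sp `|` ST m E T sm sp `|`
       closure (graph_domain m E s0m s0p) `*` [set 0])) => [[x t] [/= /andP[t0 tt] P]|].
      move: t0; rewrite le_eqVlt => /orP[/eqP t0|t0].
        by subst t; right; split => //=; exact: cl0.
      by left; apply: PhiQS => //; rewrite t0.
    exact: cu0.
  - move=> [x t] [/= /andP[_ tt] _] t0 P0; apply: uS; apply: PhiS => //.
    by rewrite t0.
  - by move=> [x t] [/= tt P]; have [dQ _ _ _ _] := Qu; have [] := dQ _ (PhiQ _ _ tt P).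
  - by move=> [x t] [/= tt P]; have [dQ _ _ _ _] := Qu; have [] := dQ _ (PhiQ _ _ tt P).
  - move=> [x t] [/= tt P]; have [dQ _ _ _ _] := Qu.
    by have [_ _ H] := dQ _ (PhiQ _ _ tt P) => i; exact: H.
  - move=> [x t] [/= tt P]; rewrite eqn; last exact: PhiQ.
    by apply: fK; exact: inT.
have uM' p : swept Phi tau p -> 0 < p.2 -> u p <= `|M|.
  case: p => x t [/= /andP[_ tt] P] t0; apply: le_trans (ler_norm _) _.
  apply: le_trans (ler_norm M); apply: uM; apply: PhiQS => //.
  by rewrite t0.
have slope : boundary_slope_ge Phi tau alpha u.
  move=> [x t] [/= /andP[_ tt] _] t0 P0.
  have tt' : 0 < t <= tau by rewrite t0.
  exists (exterior_normal m E sm sp (x, t)).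
  have inward : \forall h \near (0 : R)^'+,
      0 < Phi (x - h *: exterior_normal m E sm sp (x, t), t).
    apply: (@exterior_normal_inward R N m E hm hE T) => //; try exact: inT.
    - by case: asm.
    - by case: asp.
    - by move=> y; rewrite /gm extE.
    - by move=> y; rewrite /gp extE.
    - by move=> y; apply: smp; exact: inT.
  split => //; first exact: (exterior_normal_unit hm hE).
  apply: (boundary_slope Qu cu cG GE) => //.
  - move=> y Qy.
    have Py : 0 < Phi (y, t).
      by rewrite thickness_gt0 /= /gm /gp !extE//; case: Qy.
    have H := @continuous_slice_space _ _ y t _ (near_superlevel cPhi Py).
    by apply: (@filterS _ _ (nbhs_filter y) _ _ _ H) => z; exact: PhiQ.
  - exact: PhiS.
  - by apply: uS; exact: PhiS.
  - by apply: Gnu; exact: PhiS.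
  - by apply: filterS inward => h; exact: PhiQ.
(* the centre of the growing ball, one unit above the upper graph *)
pose c0 := (s0p 0 + 1) *: m.
have tc0 r : tcoord m E (r *: m) = 0 by rewrite tcoordZ// tcoord_axis// scaler0.
have cs0p : continuous s0p by have [[]] := hs0p.
have [d d0 hd] : exists2 d : R, 0 < d & forall x, dot x m <= s0p (tcoord m E x) ->
    d <= dot (x - c0) (x - c0).
  by apply: (graph_domain_dist hE) => //; rewrite tc0 dotZl hm mulr1 ltrDl.
apply: (@no_thin_start R N Phi tau K `|M| alpha u c0 (s0p 0 *: m) d) => //.
- by move=> x; rewrite thickness_ge0 /= /gm /gp !ext0 => /andP[_]; exact: hd.
- rewrite thickness_ge0 /= /gm /gp !ext0 tc0 dotZl hm mulr1 lexx andbT.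
  exact/ltW/hs0.
- move=> x /cl0; apply: closure_subset => z Dz.
  by rewrite /= thickness_gt0 /= /gm /gp !ext0.
Qed.
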